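(* Let $p(n)$ denote the number of integer partitions of $n$, and let $\nu(n)$ denote the number of partitions of $n$ having no part equal to $1$. Then, as $n\to\infty$, $$p(n)\ \sim\ \nu(n)\sqrt{\frac{n}{\zeta(2)}},$$ where $\zeta(2)=\pi^2/6$.
   Context: A partition with no part equal to $1$ is called a non-unitary partition. $f(n)\sim g(n)$ means $f(n)/g(n)\to 1$. *)

(* Defs.v *)
From HB Require Import structures.
From mathcomp Require Import all_boot all_order all_algebra.
From mathcomp Require Import all_classical all_reals all_analysis.
From mathcomp Require Import finmap.
Set Implicit Arguments. Unset Strict Implicit. Unset Printing Implicit Defensive.
Import Order.TTheory GRing.Theory Num.Theory.

Local Open Scope classical_set_scope.

Definition is_partition (n : nat) (s : seq nat) : bool :=
  [&& sorted geq s, all (fun x => 0 < x)%N s & sumn s == n].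

Definition partitions (n : nat) : set (seq nat) :=
  [set s | is_partition n s].
Definition nonunitary_partitions (n : nat) : set (seq nat) :=
  [set s | is_partition n s && (1%N \notin s)].

Definition p (n : nat) : nat := #|` fset_set (partitions n) |%fset.
Definition nu (n : nat) : nat := #|` fset_set (nonunitary_partitions n) |%fset.

Definition zeta2 {R : realType} : R := (pi ^+ 2 / 6)%R.

(* Main.v *)
Require Import Defs.
From HB Require Import structures.
From mathcomp Require Import all_boot all_order all_algebra.
From mathcomp Require Import all_classical all_reals all_analysis.
From mathcomp Require Import finmap zify ring lra.
Import Order.TTheory GRing.Theory Num.Theory numFieldNormedType.Exports.
Set Implicit Arguments. Unset Strict Implicit. Unset Printing Implicit Defensive.
Local Open Scope classical_set_scope.
Local Open Scope ring_scope.

(** The proof is elementary: no estimate of [p n] itself is needed. Counting the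
    parts of all partitions of [n] gives [n p(n) = sum_k sigma(k) p(n-k)], and
    differencing it gives [n nu(n) + p(n-1) = sum_k sigma(k) nu(n-k)]. Let
    [h(m) = sqrt m * nu(m) / p(m)] and [c = sqrt (zeta 2)].

    Lower bound. Let [l = liminf h], positive since [nu] is nondecreasing. The
    two recurrences express [h(n)] essentially as an average of the [h(n-k)]
    with weights [sigma(k) p(n-k) / (n p(n))], so if [h(n)] is close to [l] then
    so are the [h(n-k)] in the mean, whence [p(n-k)] is close to [x^k p(n)] with
    [x = 1 - l / sqrt n]. Since [sum_k sigma(k) x^k ~ zeta 2 / (1-x)^2], the first
    recurrence then reads [n >= (1-o(1)) n zeta 2 / l^2], that is [l >= c].

    Upper bound. By the lower bound [p(n-k) <= x^k p(n)] with
    [x = 1 - (c-e) / sqrt n], and the first recurrence shows that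
    [x^K p(n) - p(n-K)] is small relative to [p(n)] for [K] a small multiple of
    [sqrt n]. As [nu] is nondecreasing, [K nu(n-K) <= p(n) - p(n-K)] bounds
    [h(n-K)] by [c + o(1)]. *)

(** * Counting partitions *)

Definition parts (n : nat) : seq (seq nat) := enum_fset (fset_set (partitions n)).

Lemma mem_leq_sumn (s : seq nat) (x : nat) : x \in s -> (x <= sumn s)%N.
Proof. by elim: s => //= y s IH; rewrite inE => /orP[/eqP->|/IH]; lia. Qed.

Lemma size_leq_sumn (s : seq nat) : all (fun x => 0 < x)%N s -> (size s <= sumn s)%N.
Proof. by elim: s => //= y s IH /andP[y0 /IH]; lia. Qed.

(** A partition of [n] has at most [n] parts, each at most [n], so it is the image of a bounded
    sequence over ['I_n.+1]. Finiteness matters because [fset_set] is empty on an infinite set. *)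
Lemma finite_partitions (n : nat) : finite_set (partitions n).
Proof.
apply: (@sub_finite_set _ _ ((fun t : n.-bseq 'I_n.+1 => map val t) @` setT)).
  move=> s /= /and3P[_ s0 /eqP sn].
  have sz : (size (map (@inord n) s) <= n)%N by rewrite size_map -sn size_leq_sumn.
  exists (Bseq sz) => //=; rewrite -map_comp -[RHS]map_id; apply/eq_in_map => x xs /=.
  by rewrite inordK // ltnS -sn mem_leq_sumn.
by apply: finite_image; exact: finite_finset.
Qed.

Lemma mem_parts (n : nat) (s : seq nat) : (s \in parts n) = is_partition n s.
Proof.
rewrite /parts.
have -> : (s \in enum_fset (fset_set (partitions n))) = (s \in fset_set (partitions n)) by [].
rewrite in_fset_set; last exact: finite_partitions.
by apply/idP/idP => [/set_mem|h]; [|apply/mem_set].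
Qed.

Lemma uniq_parts (n : nat) : uniq (parts n).
Proof. exact: fset_uniq. Qed.

Lemma p_size (n : nat) : p n = size (parts n).
Proof. by []. Qed.

Lemma nu_count (n : nat) : nu n = count (fun s => 1%N \notin s) (parts n).
Proof.
rewrite -size_filter /nu.
have fN : finite_set (nonunitary_partitions n).
  by apply: sub_finite_set (finite_partitions n) => s /= /andP[].
apply: perm_size; apply: uniq_perm; [exact: fset_uniq|by rewrite filter_uniq ?uniq_parts|].
move=> s; rewrite mem_filter mem_parts andbC.
have -> : (s \in enum_fset (fset_set (nonunitary_partitions n))) = (s \in fset_set (nonunitary_partitions n)) by [].
by rewrite in_fset_set //; apply/idP/idP => [/set_mem|h]; [|apply/mem_set].
Qed.

(** * Inserting and removing a part *)

Definition insert_part (k : nat) (s : seq nat) : seq nat := sort geq (k :: s).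

Lemma geq_total : total geq.
Proof. by move=> x y; rewrite /geq /=; lia. Qed.

Lemma geq_trans : transitive geq.
Proof. by move=> x y z; rewrite /geq /=; lia. Qed.

Lemma geq_anti : antisymmetric geq.
Proof. by move=> x y; rewrite /geq /=; lia. Qed.

Lemma perm_insert_part (k : nat) (s : seq nat) : perm_eq (insert_part k s) (k :: s).
Proof. by rewrite /insert_part perm_sort. Qed.

Lemma is_partition_insert (n k : nat) (s : seq nat) :
  (0 < k)%N -> is_partition n s -> is_partition (n + k) (insert_part k s).
Proof.
move=> k0 /and3P[_ s0 /eqP sn]; rewrite /is_partition sort_sorted ?(perm_all _ (perm_insert_part k s)) /=; last exact: geq_total.
by rewrite k0 s0 (perm_sumn (perm_insert_part k s)) /= sn addnC eqxx.
Qed.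

Lemma is_partition_rem (n k : nat) (s : seq nat) :
  k \in s -> is_partition n s -> is_partition (n - k) (rem k s).
Proof.
move=> ks /and3P[ss s0 /eqP sn].
have pr := perm_to_rem ks.
rewrite /is_partition (subseq_sorted geq_trans (rem_subseq k s) ss) /=.
move: s0; rewrite (perm_all _ pr) /= => /andP[_ ->] /=.
by rewrite -sn (perm_sumn pr) /= addKn.
Qed.

Lemma insert_partK (n k : nat) (s : seq nat) :
  is_partition n s -> rem k (insert_part k s) = s.
Proof.
move=> /and3P[ss _ _].
have kin : k \in insert_part k s by rewrite (perm_mem (perm_insert_part k s)) mem_head.
apply: (sorted_eq geq_trans geq_anti) => //.
- apply: (subseq_sorted geq_trans (rem_subseq k _)); exact: (sort_sorted geq_total).
- rewrite -(perm_cons k); apply: perm_trans (perm_insert_part k s).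
  by rewrite perm_sym perm_to_rem.
Qed.

Lemma rem_partK (n k : nat) (s : seq nat) :
  k \in s -> is_partition n s -> insert_part k (rem k s) = s.
Proof.
move=> ks /and3P[ss _ _].
apply: (sorted_eq geq_trans geq_anti) => //; first exact: (sort_sorted geq_total).
by apply: perm_trans (perm_insert_part _ _) _; rewrite perm_sym perm_to_rem.
Qed.

(** Inserting one copy of [k] is a bijection between the two families, with inverse [rem k]. *)
Lemma count_parts_insert (n k j : nat) : (0 < k)%N ->
  count (fun s => j.+1 <= count_mem k s)%N (parts (n + k)) =
  count (fun s => j <= count_mem k s)%N (parts n).
Proof.
move=> k0; rewrite -!size_filter -[RHS](size_map (insert_part k)).
apply: perm_size; apply: uniq_perm.
- by rewrite filter_uniq ?uniq_parts.
- rewrite map_inj_in_uniq ?filter_uniq ?uniq_parts // => s t.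
  rewrite !mem_filter !mem_parts => /andP[_ ps] /andP[_ pt] e.
  by rewrite -(insert_partK k ps) e (insert_partK k pt).
move=> s; apply/idP/mapP => [|[t]].
- rewrite mem_filter mem_parts => /andP[js ps].
  have ks : k \in s by rewrite -has_pred1 has_count (leq_trans _ js).
  exists (rem k s); last by rewrite (rem_partK ks ps).
  rewrite mem_filter mem_parts; have := is_partition_rem ks ps.
  rewrite addnK => -> /=; rewrite andbT.
  by move: js; rewrite (permP (perm_to_rem ks) (pred1 k)) /= eqxx add1n ltnS.
- rewrite !mem_filter !mem_parts => /andP[jt pt] ->.
  rewrite is_partition_insert // andbT.
  by rewrite (permP (perm_insert_part k t) (pred1 k)) /= eqxx add1n ltnS.
Qed.

Lemma count_parts_big (n k j : nat) : (n < k)%N ->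
  count (fun s => j.+1 <= count_mem k s)%N (parts n) = 0%N.
Proof.
move=> nk; apply/eqP; rewrite -leqn0 leqNgt -has_count; apply/hasP => -[s].
rewrite mem_parts => /and3P[_ _ /eqP sn] js.
have ks : k \in s by rewrite -has_pred1 has_count (leq_trans _ js).
by have := mem_leq_sumn ks; rewrite sn; lia.
Qed.

(** Removing [j] copies of [k] leaves an arbitrary partition of [n - j * k]; the test guards against
    truncated subtraction. *)
Lemma count_parts (n k j : nat) : (0 < k)%N ->
  count (fun s => j <= count_mem k s)%N (parts n) = if (j * k <= n)%N then p (n - j * k) else 0%N.
Proof.
move=> k0; elim: j n => [|j IH] n.
  by rewrite mul0n leq0n subn0 p_size -size_filter filter_predT.
case: (ltnP n k) => nk.
  by rewrite count_parts_big // ifF //; nia.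
rewrite -{1}(subnK nk) count_parts_insert // IH.
have -> : (j * k <= n - k)%N = (j.+1 * k <= n)%N by rewrite mulSn; lia.
by rewrite mulSn subnDA.
Qed.

Lemma p0 : p 0 = 1%N.
Proof.
rewrite p_size; have -> : parts 0 = [:: [::]] => //.
apply: perm_small_eq => //; apply: uniq_perm => //; first exact: uniq_parts.
move=> s; rewrite mem_parts inE; apply/idP/eqP => [/and3P[_ /size_leq_sumn h /eqP e]|->//].
by move: h; rewrite e; case: s {e}.
Qed.

Lemma pS (n : nat) : p n.+1 = (nu n.+1 + p n)%N.
Proof.
(* With [k = j = 1]: the partitions of [n.+1] that contain a [1] number [p n]. *)
have := @count_parts n.+1 1 1 isT; rewrite mul1n ltnS leq0n subSS subn0 => <-.
rewrite nu_count p_size -(count_predC (fun s => 1%N \notin s)); congr addn.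
by apply: eq_count => s /=; rewrite negbK -has_pred1 has_count.
Qed.

(** Increasing the largest part by one is injective and creates no part [1]. The index starts at [1]
    because [nu 0 = 1] while [nu 1 = 0]. *)
Lemma nu_leS (n : nat) : (nu n.+1 <= nu n.+2)%N.
Proof.
pose f (s : seq nat) := if s is x :: t then x.+1 :: t else s.
rewrite !nu_count -!size_filter -(size_map f); apply: uniq_leq_size.
  rewrite map_inj_in_uniq ?filter_uniq ?uniq_parts // => s t _ _.
  by case: s => [|x s]; case: t => [|y t] //= [-> ->].
move=> _ /mapP[s + ->]; rewrite !mem_filter !mem_parts.
case: s => [|x s] /andP[]; first by rewrite /is_partition.
rewrite /= inE negb_or => /andP[x1 s1] /and3P[/= ss /andP[x0 s0] /eqP sn].
rewrite inE negb_or s1 /is_partition /= s0 addSn sn eqxx !andbT.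
apply/andP; split; first by lia.
by case: s ss {s1 s0 sn} => //= y s /andP[xy ->]; rewrite andbT; lia.
Qed.

(** * The divisor sum and the recurrence for [p] *)

Definition sigma (k : nat) : nat := \sum_(1 <= d < k.+1 | (d %| k)%N) d.

Lemma sumn_count (n : nat) (s : seq nat) : is_partition n s ->
  (sumn s = \sum_(1 <= k < n.+1) k * count_mem k s)%N.
Proof.
move=> /and3P[_ s0 /eqP sn].
have : all (fun x => 0 < x <= n)%N s.
  apply/allP => x xs; rewrite (allP s0 _ xs) -sn; exact: mem_leq_sumn.
elim: s {s0 sn} => [_|x s IH /= /andP[xn /IH ->]].
  by rewrite big1 // => k _; rewrite muln0.
under [RHS]eq_bigr do rewrite mulnDr.
rewrite big_split /=; congr addn.
rewrite (bigD1_seq x) /= ?mem_index_iota ?iota_uniq // eqxx muln1 big1 ?addn0 // => i /negbTE ix.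
by rewrite eq_sym ix muln0.
Qed.

Lemma count_mem_sum (n k : nat) (s : seq nat) : (0 < k)%N -> is_partition n s ->
  (count_mem k s = \sum_(1 <= j < n.+1) (j <= count_mem k s))%N.
Proof.
move=> k0 /and3P[_ s0 /eqP sn].
have cn : (count_mem k s <= n)%N.
  by apply: leq_trans (count_size _ _) _; rewrite -sn size_leq_sumn.
rewrite (big_cat_nat (n := (count_mem k s).+1)) //= [X in (X + _)%N]big_nat_cond.
rewrite (eq_bigr (fun=> 1%N)); last by move=> i /andP[/andP[_ +] _]; rewrite ltnS => ->.
rewrite -big_nat_cond sum_nat_const_nat muln1 subSS subn0 [X in (_ + X)%N]big_nat_cond.
by rewrite big1 ?addn0 // => i /andP[/andP[+ _] _]; rewrite ltnNge => /negbTE->.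
Qed.

Lemma sum_multiples (V : nmodType) (n d : nat) (g : nat -> V) : (0 < d)%N ->
  \sum_(1 <= k < n.+1 | (d %| k)%N) g k =
  \sum_(1 <= j < n.+1 | (j * d <= n)%N) g (j * d)%N.
Proof.
move=> d0.
have -> : \sum_(1 <= j < n.+1 | (j * d <= n)%N) g (j * d)%N =
    \sum_(1 <= j < n.+1) \sum_(1 <= k < n.+1 | k == (j * d)%N) g k.
  rewrite big_nat_cond big_mkcond [RHS]big_nat_cond [RHS]big_mkcond.
  apply: eq_bigr => j _; rewrite andbT; case: ifP => [/andP[/andP[j1 jn] jd]|jn].
    rewrite j1 jn big_mkcond (bigD1_seq (j * d)%N) /= ?iota_uniq ?mem_index_iota //.
      by rewrite eqxx big1 ?addr0 // => i /negbTE->.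
    by rewrite ltnS jd muln_gt0 j1 d0.
  case: ifP => // jn'; rewrite big_nat_cond big1 // => i /andP[ik /eqP ij].
  by move: jn; rewrite jn' -ij /=; lia.
rewrite (exchange_big_dep (fun k => (d %| k)%N)) /=; last first.
  by move=> j k _ /eqP->; rewrite dvdn_mull.
rewrite big_nat_cond [RHS]big_nat_cond; apply: eq_bigr => k /andP[k1n dk].
rewrite big_mkcond (bigD1_seq (k %/ d)%N) /= ?iota_uniq ?mem_index_iota ?divnK //.
  rewrite eqxx big1 ?addr0 // => i ik; case: eqP => // kE.
  by move: ik; rewrite kE mulnK // eqxx.
rewrite divn_gt0 // dvdn_leq /=; last by []; last by lia.
by apply: leq_ltn_trans (leq_div _ _) _; lia.
Qed.

(** Each pair of [k] and a divisor [d] of [k] is reindexed by [k = j * d]. *)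
Lemma sum_sigma (R : pzRingType) (n : nat) (f : nat -> R) :
  \sum_(1 <= k < n.+1) (sigma k)%:R * f k =
  \sum_(1 <= d < n.+1) \sum_(1 <= j < n.+1 | (j * d <= n)%N) d%:R * f (j * d)%N.
Proof.
transitivity (\sum_(1 <= k < n.+1) \sum_(1 <= d < n.+1 | (d %| k)%N) d%:R * f k).
  rewrite !big_nat; apply: eq_bigr => k k1n; rewrite /sigma natr_sum mulr_suml.
  rewrite [RHS](big_cat_nat (n := k.+1)) //=; last by lia.
  rewrite [X in _ + X]big_nat_cond [X in _ + X]big1 ?addr0 // => d /andP[kd /dvdn_leq]; lia.
rewrite (exchange_big_dep predT) //= !big_nat; apply: eq_bigr => d d1n.
by rewrite (@sum_multiples _ n d (fun k => d%:R * f k)) //; lia.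
Qed.

(** Double counting of the sum of all parts of all partitions of [n]: a part size [d] and a
    threshold [j] contribute [d] times the number of partitions with at least [j] copies of [d],
    which is [p (n - j * d)]. *)
Lemma p_recurrence (R : pzRingType) (n : nat) :
  n%:R * (p n)%:R = \sum_(1 <= k < n.+1) (sigma k)%:R * (p (n - k))%:R :> R.
Proof.
rewrite sum_sigma.
have -> : n%:R * (p n)%:R = (\sum_(s <- parts n) sumn s)%:R :> R.
  rewrite (eq_big_seq (fun=> n)) => [|s]; last by rewrite mem_parts => /and3P[_ _ /eqP].
  by rewrite big_const_seq count_predT iter_addn_0 -p_size natrM.
rewrite (eq_big_seq (fun s => \sum_(1 <= d < n.+1) \sum_(1 <= j < n.+1) d * (j <= count_mem d s))%N); last first.
  move=> s; rewrite mem_parts => ps; rewrite (sumn_count ps) !big_nat.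
  by apply: eq_bigr => d /andP[d0 _]; rewrite -big_distrr /= -(count_mem_sum d0 ps).
rewrite exchange_big /= natr_sum !big_nat; apply: eq_bigr => d /andP[d0 _].
rewrite exchange_big /= natr_sum [RHS]big_mkcond /=; apply: eq_bigr => j _.
rewrite -big_distrr /=.
have -> : (\sum_(s <- parts n) (j <= count_mem d s) =
    count (fun s => j <= count_mem d s) (parts n))%N.
  by rewrite -sum1_count [RHS]big_mkcond /=; apply: eq_bigr => s _; case: ifP.
by rewrite count_parts //; case: ifP => _; rewrite natrM ?mulr0.
Qed.

Lemma p_gt0 (n : nat) : (0 < p n)%N.
Proof. by elim: n => [|n IH]; rewrite ?p0 // pS addn_gt0 IH orbT. Qed.

Lemma sigma_ge (k : nat) : (0 < k)%N -> (k <= sigma k)%N.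
Proof.
by move=> k0; rewrite /sigma big_mkcond big_nat_recr //= dvdnn; lia.
Qed.

Lemma sigma_gt (k : nat) : (1 < k)%N -> (k < sigma k)%N.
Proof.
move=> k1; rewrite /sigma big_mkcond big_nat_recr //=; last lia.
by rewrite dvdnn big_ltn //= dvd1n; lia.
Qed.

(** Each divisor [d] contributes [d * (n %/ d) <= n]. *)
Lemma sum_sigma_le (n : nat) : (\sum_(1 <= k < n.+1) sigma k <= n ^ 2)%N.
Proof.
rewrite -(ler_nat int) natr_sum.
rewrite (eq_bigr (fun k => (sigma k)%:R * (1 : int))) => [|k _]; last by rewrite mulr1.
rewrite (@sum_sigma int n (fun=> 1)); apply: (@le_trans _ _ (\sum_(1 <= d < n.+1) n%:R)); last first.
  by rewrite sumr_const_nat subn1 /= -[_%:R *+ _]mulr_natr -natrM mulnn.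
rewrite !big_nat; apply: ler_sum => d d1.
rewrite mulr1 -big_filter big_const_seq count_predT iter_addr_0 -[_%:R *+ _]mulr_natr -natrM ler_nat.
have -> : [seq j <- index_iota 1 n.+1 | (j * d <= n)%N] = index_iota 1 (n %/ d).+1.
  apply: (sorted_eq leq_trans anti_leq).
  - exact: (sorted_filter leq_trans _ (iota_sorted _ _)).
  - exact: iota_sorted.
  - apply: uniq_perm; rewrite ?filter_uniq ?iota_uniq // => j.
    by rewrite mem_filter !mem_index_iota !ltnS leq_divRL //; nia.
by rewrite size_iota subn1 mulnC leq_trunc_div.
Qed.

(** * The value of zeta(2) *)

Definition inv_squares (R : realType) (n : nat) : R :=
  \sum_(1 <= j < n.+1) (j%:R ^+ 2)^-1.

Definition inv_odd_squares (R : realType) (n : nat) : R :=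
  \sum_(0 <= k < n) ((k.*2.+1)%:R ^+ 2)^-1.

Lemma sum_doubling (V : nmodType) (n : nat) (g : nat -> V) :
  \sum_(0 <= k < n.*2) g k = \sum_(0 <= k < n) (g k.*2 + g k.*2.+1).
Proof.
elim: n => [|n IH]; first by rewrite !big_geq.
by rewrite doubleS !big_nat_recr //= IH addrA.
Qed.

(** Amounts to [1 / sin^2 + 1 / cos^2 = 1 / (sin cos)^2], since a shift by [pi / 2] turns sine into
    cosine. *)
Lemma inv_sin2_double (R : realType) (x : R) : sin (x *+ 2) != 0 ->
  (sin (x *+ 2) ^+ 2)^-1 = 4^-1 * ((sin x ^+ 2)^-1 + (sin (x + pi / 2) ^+ 2)^-1).
Proof.
rewrite sinDpihalf sin_mulr2n mulrn_eq0 /= mulf_eq0 negb_or => /andP[c0 s0].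
have := cos2Dsin2 x; set c := cos x in c0 *; set s := sin x in s0 * => cs.
transitivity ((c ^+ 2 + s ^+ 2) / ((c * s *+ 2) ^+ 2)); first by rewrite cs mul1r.
by field; rewrite c0 s0.
Qed.

(** The angle is halved [n] times; even and odd indices [k] come from the two summands of
    [inv_sin2_double]. *)
Lemma inv_sin2_sum (R : realType) (n : nat) (x : R) : sin x != 0 ->
  \sum_(0 <= k < 2 ^ n) (sin ((x + k%:R * pi) / 2 ^+ n) ^+ 2)^-1 = 4 ^+ n * (sin x ^+ 2)^-1.
Proof.
elim: n x => [|n IH] x sx.
  by rewrite expn0 big_nat1 mul0r addr0 expr0 divr1 mul1r.
have xE : x = (x / 2) *+ 2 by rewrite -mulr_natr; field.
have sx2 : sin ((x / 2) *+ 2) != 0 by rewrite -xE.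
have s1 : sin (x / 2) != 0.
  by move: sx2; rewrite sin_mulr2n mulrn_eq0 /= mulf_eq0 negb_or => /andP[].
have s2 : sin (x / 2 + pi / 2) != 0.
  by move: sx2; rewrite sinDpihalf sin_mulr2n mulrn_eq0 /= mulf_eq0 negb_or => /andP[].
rewrite expnS mul2n sum_doubling big_split /= [in RHS]xE inv_sin2_double //.
have -> : 4 ^+ n.+1 * (4^-1 * ((sin (x / 2) ^+ 2)^-1 + (sin (x / 2 + pi / 2) ^+ 2)^-1)) =
  4 ^+ n * (sin (x / 2) ^+ 2)^-1 + 4 ^+ n * (sin (x / 2 + pi / 2) ^+ 2)^-1.
  by rewrite exprS; field; rewrite s1 s2.
rewrite -!IH //; congr (_ + _); apply: eq_bigr => k _; congr ((sin _ ^+ 2)^-1).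
  by rewrite -muln2 natrM exprS; field; rewrite expf_neq0.
by rewrite -muln2 -natr1 natrM exprS; field; rewrite expf_neq0.
Qed.

Lemma sin_le_id (R : realType) (x : R) : 0 < x < pi / 2 -> x * cos x <= sin x <= x.
Proof.
move=> /andP[x0 xpi].
have [|c cx] := @MVT R sin cos 0 x x0 (fun y _ => is_derive_sin y).
  by apply: continuous_subspaceT; exact: continuous_sin.
rewrite sin0 !subr0 => ->; move: cx; rewrite in_itv /= => /andP[c0 cx].
rewrite [x * _]mulrC !(ler_pM2r, ger_pMl) // cos_le1 andbT.
have pi0 := @pi_gt0 R.
by apply/ltW; rewrite ltr_cos // in_itv /=; lra.
Qed.

(** The left inequality is [cot x <= 1 / x] squared, because [1 / sin^2 - 1 = cot^2]. *)
Lemma inv_sin2_bounds (R : realType) (x : R) : 0 < x < pi / 2 ->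
  (sin x ^+ 2)^-1 - 1 <= (x ^+ 2)^-1 <= (sin x ^+ 2)^-1.
Proof.
move=> xpi; have s0 := sin_gt0_pihalf xpi; have /andP[lo up] := sin_le_id xpi.
move: (xpi) => /andP[x0 xp].
apply/andP; split; last by rewrite lef_pV2 ?posrE ?exprn_gt0 // lerXn2r ?nnegrE ?(ltW s0) ?(ltW x0).
have -> : (sin x ^+ 2)^-1 - 1 = cos x ^+ 2 / sin x ^+ 2.
  by rewrite cos2sin2; field; rewrite gt_eqF.
rewrite ler_pdivrMr ?exprn_gt0 // mulrC ler_pdivlMr ?exprn_gt0 // -exprMn [cos x * x]mulrC.
have c0 : 0 < cos x by apply: cos_gt0_pihalf; have := @pi_gt0 R; lra.
by rewrite lerXn2r ?nnegrE ?mulr_ge0 ?(ltW s0) ?(ltW x0) ?(ltW c0).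
Qed.

(** At [x = pi / 2], [inv_sin2_sum] makes the sum of [1 / sin^2] over the angles
    [(2 k + 1) pi / (4 M)], [k < M], exactly [2 M^2]; replacing each [1 / sin^2] by the inverse
    square of the angle costs at most [1] per term. *)
Lemma inv_odd_squares_bounds (R : realType) (m : nat) :
  pi ^+ 2 / 8 - pi ^+ 2 / 16 / 2 ^+ m <= inv_odd_squares R (2 ^ m) <= pi ^+ 2 / 8.
Proof.
have pi0 := @pi_gt0 R; set M := (2 ^ m)%N.
have piN0 : pi != 0 :> R by rewrite gt_eqF.
have M0 : (0 : R) < M%:R by rewrite ltr0n expn_gt0.
have ME : 2 ^+ m = M%:R :> R by rewrite natrX.
pose y (k : nat) : R := (pi / 2 + k%:R * pi) / 2 ^+ m.+1.
have yE k : y k = (k.*2.+1)%:R * pi / (4 * M%:R).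
  have -> : (k.*2.+1)%:R = 2 * k%:R + 1 :> R by rewrite -[LHS]natr1 -muln2 natrM mulrC.
  by rewrite /y exprS ME; field; rewrite gt_eqF.
have S : \sum_(0 <= k < M) (sin (y k) ^+ 2)^-1 = 2 * M%:R ^+ 2.
  have := @inv_sin2_sum R m.+1 (pi / 2).
  rewrite sin_pihalf oner_neq0 expr1n invr1 mulr1 => /(_ isT).
  rewrite (big_cat_nat (n := M)) //=; last by rewrite leq_exp2l.
  (* The angles with index at least [M] are the reflections [pi - y k], so the two halves of the sum
     agree. *)
  rewrite [X in _ + X](_ : _ = \sum_(0 <= k < M) (sin (y k) ^+ 2)^-1); last first.
    have -> : (2 ^ m.+1 = M + M)%N by rewrite expnS mul2n addnn.
    rewrite -[X in \sum_(X <= _ < _) _]add0n big_addn addnK big_nat_rev /= add0n.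
    rewrite !big_nat; apply: eq_bigr => k kM; congr ((_ ^+ 2)^-1).
    rewrite -[LHS]opprK -sinN -sinDpi; congr sin.
    have -> : (M - k.+1 + M)%:R = 2 * M%:R - k%:R - 1 :> R.
      have kM' : (k.+1 <= M)%N by lia.
      by rewrite natrD natrB // -natr1; ring.
    by rewrite /y exprS ME; field; rewrite gt_eqF.
  have -> : (4 : R) ^+ m.+1 = 4 * M%:R ^+ 2 by rewrite exprS -ME -exprM mulnC exprM -(natrX _ 2 2).
  by rewrite -/y /y; lra.
have Y : \sum_(0 <= k < M) (y k ^+ 2)^-1 = 16 * M%:R ^+ 2 / pi ^+ 2 * inv_odd_squares R M.
  rewrite /inv_odd_squares mulr_sumr; apply: eq_bigr => k _; rewrite yE.
  have k0 : (k.*2.+1)%:R != 0 :> R by rewrite pnatr_eq0.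
  by move: (k.*2.+1)%:R (pi : R) k0 piN0 => z q z0 q0; field; rewrite z0 q0 gt_eqF.
have yb k : (k < M)%N -> 0 < y k < pi / 2.
  move=> kM; rewrite yE divr_gt0 ?mulr_gt0 ?ltr0Sn //=.
  rewrite ltr_pdivrMr ?mulr_gt0 ?ltr0Sn // mulrC -subr_gt0.
  have : (k.*2.+1)%:R < (M.*2)%:R :> R by rewrite ltr_nat; lia.
  by rewrite -[M.*2]muln2 natrM; nra.
have up : \sum_(0 <= k < M) (y k ^+ 2)^-1 <= 2 * M%:R ^+ 2.
  by rewrite -S !big_nat; apply: ler_sum => i iM; have /andP[] := inv_sin2_bounds (yb i iM).
have lo : 2 * M%:R ^+ 2 - M%:R <= \sum_(0 <= k < M) (y k ^+ 2)^-1.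
  rewrite -S -[X in _ - X]mulr1.
  have -> : M%:R * 1 = \sum_(0 <= k < M) (1 : R) by rewrite sumr_const_nat subn0 mulr1.
  rewrite -sumrB !big_nat; apply: ler_sum => i iM.
  by have /andP[] := inv_sin2_bounds (yb i iM).
move: up lo; rewrite Y; set O := inv_odd_squares R M => up lo.
have c0 : (0 : R) < 16 * M%:R ^+ 2 / pi ^+ 2.
  by apply: divr_gt0; [apply: mulr_gt0 => //; exact: exprn_gt0|exact: exprn_gt0].
rewrite ME; apply/andP; split; rewrite -(ler_pM2l c0).
  apply: le_trans lo; rewrite le_eqVlt; apply/orP; left; apply/eqP.
  by move: (pi : R) piN0 => q q0; field; rewrite q0 gt_eqF.
apply: le_trans up _; rewrite le_eqVlt; apply/orP; left; apply/eqP.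
by move: (pi : R) piN0 => q q0; field; rewrite q0.
Qed.

Lemma inv_squares_double (R : realType) (n : nat) :
  inv_squares R n.*2 = inv_odd_squares R n + inv_squares R n / 4.
Proof.
rewrite /inv_squares /inv_odd_squares !big_add1 /= sum_doubling big_split /=; congr (_ + _).
rewrite mulr_suml; apply: eq_bigr => k _.
have k0 : k.+1%:R != 0 :> R by rewrite pnatr_eq0.
by rewrite -doubleS -muln2 natrM; move: k.+1%:R k0 => z z0; field.
Qed.

Lemma inv_squares_ge0 (R : realType) (n : nat) : 0 <= inv_squares R n.
Proof. by apply: sumr_ge0 => k _; rewrite invr_ge0 exprn_ge0. Qed.

Lemma inv_squares_le_mono (R : realType) (m n : nat) : (m <= n)%N ->
  inv_squares R m <= inv_squares R n.
Proof.
move=> mn; rewrite /inv_squares [leRHS](big_cat_nat (n := m.+1)) //=.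
by rewrite lerDl; apply: sumr_ge0 => k _; rewrite invr_ge0 exprn_ge0.
Qed.

(** The value [pi^2 / 6] is the fixed point of [s = pi^2 / 8 + s / 4], so by [inv_squares_double]
    the bound propagates along powers of two. *)
Lemma inv_squares_le (R : realType) (n : nat) : inv_squares R n <= pi ^+ 2 / 6.
Proof.
apply: (le_trans (inv_squares_le_mono R (ltnW (ltn_expl n (leqnn 2))))).
elim: n => [|n IH].
  have /andP[_] := inv_odd_squares_bounds R 0.
  rewrite /inv_squares /inv_odd_squares expn0 !big_nat1 => h.
  by apply: (le_trans h); have := sqr_ge0 (pi : R); lra.
rewrite expnS mul2n inv_squares_double.
have /andP[_] := inv_odd_squares_bounds R n; lra.
Qed.

(** The constant [pi^2 / 4] makes the induction close exactly: [1/16 + (1/4)/4 = (1/4)/2]. *)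
Lemma inv_squares_ge (R : realType) (m : nat) :
  pi ^+ 2 / 6 - pi ^+ 2 / 4 / 2 ^+ m <= inv_squares R (2 ^ m).
Proof.
have pi2 := sqr_ge0 (pi : R).
elim: m => [|m IH].
  by have := inv_squares_ge0 R (2 ^ 0); rewrite expr0; lra.
rewrite expnS mul2n inv_squares_double.
have /andP[+ _] := inv_odd_squares_bounds R m.
rewrite [2 ^+ m.+1]exprS invfM; move: IH; set i := (2 ^+ m)^-1.
by rewrite -/i; lra.
Qed.

(** * Lambert series of sigma *)

Lemma sum_id_geometric (R : comPzRingType) (M : nat) (y : R) :
  (1 - y) ^+ 2 * \sum_(1 <= d < M.+1) d%:R * y ^+ d = y - y ^+ M.+1 * (1 + M%:R * (1 - y)).
Proof.
elim: M => [|M IH]; first by rewrite big_geq //; ring.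
by rewrite big_nat_recr //= mulrDr IH !exprS -natr1; ring.
Qed.

Lemma sum_id_geometric_le (R : realFieldType) (M : nat) (y : R) : 0 <= y < 1 ->
  \sum_(1 <= d < M.+1) d%:R * y ^+ d <= y / (1 - y) ^+ 2.
Proof.
move=> /andP[y0 y1]; rewrite ler_pdivlMr ?exprn_gt0 ?subr_gt0 // mulrC sum_id_geometric.
by rewrite gerBl mulr_ge0 ?exprn_ge0 // addr_ge0 // mulr_ge0 // subr_ge0 ltW.
Qed.

Lemma bernoulli_le (R : realFieldType) (n : nat) (a : R) : 0 <= a <= 1 ->
  1 - n%:R * a <= (1 - a) ^+ n.
Proof.
move=> /andP[a0 a1]; elim: n => [|n IH]; first by rewrite mul0r subr0.
have n0 : 0 <= n%:R :> R by [].
by rewrite exprS -natr1; nra.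
Qed.

(** Serves as the upper bound [1 / (1 + n a)] for [(1 - a)^n], in place of an exponential
    estimate. *)
Lemma bernoulli_inv (R : realFieldType) (n : nat) (a : R) : 0 <= a <= 1 ->
  (1 - a) ^+ n * (1 + n%:R * a) <= 1.
Proof.
move=> /andP[a0 a1]; elim: n => [|n IH]; first by rewrite mul0r addr0 mulr1.
have n0 : 0 <= n%:R :> R by [].
have x0 : 0 <= (1 - a) ^+ n by rewrite exprn_ge0 // subr_ge0.
apply: le_trans IH; rewrite exprSr -natr1 -mulrA ler_wpM2l //.
by have := mulr_ge0 n0 (sqr_ge0 a); nra.
Qed.

(* AM-GM for [1 + s^2 + ... + s^(2j-2)], multiplied by [s (1 - s^2)]. *)
Lemma geometric_amgm (R : realFieldType) (j : nat) (s : R) : 0 <= s <= 1 ->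
  j%:R * s ^+ j * (1 - s ^+ 2) <= s * (1 - (s ^+ j) ^+ 2).
Proof.
move=> /andP[s0 s1]; elim: j => [|j IH]; first by rewrite !mul0r expr1n subrr mulr0.
have t0 : 0 <= s ^+ j by rewrite exprn_ge0.
have t1 : s ^+ j <= 1 by rewrite exprn_ile1.
rewrite exprS -natr1; move: (s ^+ j) (j%:R) t0 t1 IH => t i t0 t1 IH.
have : s * (i * t * (1 - s ^+ 2)) <= s * (s * (1 - t ^+ 2)) by rewrite ler_wpM2l.
have : 0 <= s * ((1 - s) * (1 - t) * (1 - s * t)).
  by rewrite !mulr_ge0 ?subr_ge0 // mulr_ile1.
nra.
Qed.

(** This is [geometric_amgm] at [s = sqrt x], squared, with a factor [x <= 1] dropped. Once
    multiplied by [(1 - x)^2] the bound is uniform in [x], so summing over [j] yields [zeta2] with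
    no limit process. *)
Lemma geometric_ratio_le (R : rcfType) (j : nat) (x : R) : 0 <= x < 1 -> (0 < j)%N ->
  x ^+ j / (1 - x ^+ j) ^+ 2 <= (j%:R ^+ 2)^-1 / (1 - x) ^+ 2.
Proof.
move=> /andP[x0 x1] j0; have j0' : (0 : R) < j%:R by rewrite ltr0n.
have xj : x ^+ j < 1 by rewrite exprn_ilt1 // -lt0n.
rewrite ler_pdivrMr ?exprn_gt0 ?subr_gt0 // mulrAC ler_pdivlMr ?exprn_gt0 ?subr_gt0 //.
rewrite ler_pdivlMl ?exprn_gt0 //.
have s1 : 0 <= Num.sqrt x <= 1 by rewrite sqrtr_ge0 -sqrtr1 ler_wsqrtr ?ltW.
have := geometric_amgm j s1; rewrite -exprM mulnC exprM sqr_sqrtr // => h.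
have : (j%:R * Num.sqrt x ^+ j * (1 - x)) ^+ 2 <= (Num.sqrt x * (1 - x ^+ j)) ^+ 2.
  rewrite lerXn2r // nnegrE ?mulr_ge0 ?sqrtr_ge0 ?exprn_ge0 ?subr_ge0 ?sqrtr_ge0 ?(ltW x1) ?(ltW xj) //.
rewrite !exprMn -[(Num.sqrt x ^+ j) ^+ 2]exprM mulnC exprM sqr_sqrtr // -mulrA => h2.
apply: (le_trans h2); rewrite ler_piMl ?sqr_ge0 // ltW //.
Qed.

(** Once the double sum is exchanged, the inner sums over [d] are at most [x^j / (1 - x^j)^2], to
    which [geometric_ratio_le] applies. *)
Lemma sum_sigma_exp_le (R : realType) (n : nat) (x : R) : 0 <= x < 1 ->
  \sum_(1 <= k < n.+1) (sigma k)%:R * x ^+ k <= zeta2 / (1 - x) ^+ 2.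
Proof.
move=> x01; move: (x01) => /andP[x0 x1].
rewrite (@sum_sigma R n (fun k => x ^+ k)).
apply: (@le_trans _ _ (\sum_(1 <= d < n.+1) \sum_(1 <= j < n.+1) d%:R * (x ^+ j) ^+ d)).
  apply: ler_sum => d _; rewrite big_mkcond; apply: ler_sum => j _; rewrite exprM.
  by case: ifP => // _; rewrite mulr_ge0 ?exprn_ge0.
rewrite exchange_big /=.
apply: (@le_trans _ _ (inv_squares R n / (1 - x) ^+ 2)); last first.
  by rewrite ler_pM2r ?invr_gt0 ?exprn_gt0 ?subr_gt0 // inv_squares_le.
rewrite /inv_squares mulr_suml !big_nat; apply: ler_sum => j /andP[j0 _].
apply: le_trans (geometric_ratio_le x01 j0); apply: sum_id_geometric_le.
by rewrite exprn_ge0 // exprn_ilt1 // -lt0n.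
Qed.

(** Up to a factor [1 - u], the truncation error is [t^2 (1 + 2 w)] with [t = (1 - u)^N] and
    [w = N u]. Two factors [t <= 1 / (1 + w)] beat the linear one, which is why the sum runs to
    [2 N]. *)
Lemma sum_id_geometric_ge (R : realFieldType) (N : nat) (u : R) : 0 < u <= 1 ->
  (1 - u) * (1 - 2 / (1 + N%:R * u)) / u ^+ 2 <= \sum_(1 <= d < N.*2.+1) d%:R * (1 - u) ^+ d.
Proof.
move=> /andP[u0 u1]; rewrite ler_pdivrMr ?exprn_gt0 // [leRHS]mulrC.
have := sum_id_geometric N.*2 (1 - u); rewrite subKr => ->.
rewrite exprS -addnn exprD natrD [(N%:R + N%:R) * u]mulrDl.
have n0 : 0 <= N%:R :> R by []; have Nu : 0 <= N%:R * u by rewrite mulr_ge0 // ltW.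
have u01 : 0 <= u <= 1 by rewrite ltW.
have := bernoulli_inv N u01.
have x0 : 0 <= (1 - u) ^+ N by rewrite exprn_ge0 // subr_ge0.
move: ((1 - u) ^+ N) x0 => t t0; move: (N%:R * u) Nu => w w0 tw.
have w1 : 0 < 1 + w by rewrite ltr_pwDl.
rewrite -subr_ge0.
rewrite [leRHS](_ : _ = (1 - u) * (2 / (1 + w) - t * t * (1 + (w + w)))); last by ring.
rewrite mulr_ge0 ?subr_ge0 // ler_pdivlMr //.
have : t * (1 + w) * (t * (1 + w)) <= 1 by rewrite mulr_ile1 // mulr_ge0 // ltW.
have : 0 <= t * t by rewrite mulr_ge0.
nra.
Qed.

(** Only the pairs [d <= 2 N], [j <= J] are kept; their products stay within [K]. The condition
    [1 <= N a] makes the truncation factor nonnegative. *)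
Lemma sum_sigma_exp_ge (R : realType) (J N K : nat) (a : R) : 0 < a < 1 ->
  (N.*2 * J <= K)%N -> 1 <= N%:R * a ->
  (1 - J%:R * a) * (1 - 2 / (1 + N%:R * a)) * inv_squares R J / a ^+ 2 <=
  \sum_(1 <= k < K.+1) (sigma k)%:R * (1 - a) ^+ k.
Proof.
move=> /andP[a0 a1] NJK Na; set x := 1 - a.
have x0 : 0 < x by rewrite subr_gt0.
have x1 : x < 1 by rewrite gtrBl.
have a01 : 0 <= a <= 1 by rewrite !ltW.
have aE : a = 1 - x by rewrite subKr.
rewrite (@sum_sigma R K (fun k => x ^+ k)).
have [/eqP J0|J0] := boolP (J == 0%N).
  rewrite J0 /inv_squares big_geq // mulr0 mul0r.
  by apply: sumr_ge0 => d _; apply: sumr_ge0 => j _; rewrite mulr_ge0 // exprn_ge0 // ltW.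
have N0 : (0 < N)%N by case: N Na {NJK} => //; rewrite mul0r; lra.
have JK : (J <= K)%N by nia.
have NK : (N.*2 <= K)%N by nia.
apply: (@le_trans _ _ (\sum_(1 <= d < N.*2.+1) \sum_(1 <= j < J.+1) d%:R * (x ^+ j) ^+ d)); last first.
  have nn d : 0 <= \sum_(1 <= j < K.+1 | (j * d <= K)%N) d%:R * x ^+ (j * d).
    by apply: sumr_ge0 => j _; rewrite mulr_ge0 // exprn_ge0 // ltW.
  rewrite [leRHS](big_cat_nat (n := N.*2.+1)) //= -[leLHS]addr0 lerD ?sumr_ge0 //.
  rewrite !big_nat; apply: ler_sum => d /andP[d0 dN].
  rewrite [leRHS]big_mkcond [leRHS](big_cat_nat (n := J.+1)) //= -[leLHS]addr0 lerD ?sumr_ge0 //.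
    rewrite !big_nat; apply: ler_sum => j /andP[j0 jJ]; rewrite exprM ifT //.
    by apply: leq_trans NJK; rewrite mulnC leq_mul.
  by move=> j _; case: ifP => // _; rewrite mulr_ge0 // exprn_ge0 // ltW.
rewrite exchange_big /=; set C := 1 - 2 / (1 + N%:R * a).
have w0 : 0 < 1 + N%:R * a by lra.
have C0 : 0 <= C by rewrite subr_ge0 ler_pdivrMr //; lra.
rewrite -mulrA /inv_squares mulr_suml mulr_sumr !big_nat; apply: ler_sum => j /andP[j0 jJ].
(* [u] lies between [a] and [j a]: the lower end makes the truncation factor uniform in [j], the
   upper end turns [1 / u^2] into [1 / (j a)^2]. *)
pose u := 1 - x ^+ j.
have uE : x ^+ j = 1 - u by rewrite subKr.
have j0' : (0 : R) < j%:R by rewrite ltr0n.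
have xj0 : 0 <= x ^+ j by rewrite exprn_ge0 // ltW.
have au : a <= u.
  by rewrite /u aE lerD2l lerN2 -[leRHS]expr1 ler_wiXn2l // ltW.
have u0 : 0 < u by apply: lt_le_trans au.
have uja : u <= j%:R * a by have := bernoulli_le j a01; rewrite -/x /u; lra.
have u01 : 0 < u <= 1 by rewrite u0 /u gerBl.
have Jx : 1 - J%:R * a <= x ^+ j.
  by apply: le_trans (bernoulli_le J a01) _; rewrite -/x ler_wiXn2l // ltW.
rewrite uE; apply: le_trans (sum_id_geometric_ge N u01); rewrite -uE.
apply: (@le_trans _ _ (x ^+ j * C / u ^+ 2)); last first.
  rewrite ler_pM2r ?invr_gt0 ?exprn_gt0 // ler_wpM2l // /C lerD2l lerN2.
  rewrite ler_pM2l // lef_pV2 ?posrE ?ltr_pwDl ?mulr_ge0 ?(ltW u0) ?(ltW a0) //.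
  by rewrite lerD2l ler_wpM2l.
apply: (@le_trans _ _ (x ^+ j * C * ((j%:R ^+ 2)^-1 / a ^+ 2))).
  by rewrite ler_wpM2r ?mulr_ge0 ?invr_ge0 ?exprn_ge0 ?(ltW a0) // ler_wpM2r.
rewrite ler_wpM2l ?mulr_ge0 // -invfM -exprMn lef_pV2 ?posrE ?exprn_gt0 ?mulr_gt0 //.
by rewrite lerXn2r ?nnegrE ?mulr_ge0 ?(ltW u0) ?(ltW a0).
Qed.

(** * Recurrences for p and nu *)

Lemma nu0 : nu 0 = 1%N.
Proof.
have := p0; rewrite p_size nu_count; case E : (parts 0) => [|s [|]] //= _.
have := mem_head s [::]; rewrite -E mem_parts => /and3P[_ /size_leq_sumn h /eqP e].
by move: h; rewrite e; case: s {E e}.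
Qed.

Lemma p_le_mono (m n : nat) : (m <= n)%N -> (p m <= p n)%N.
Proof.
move=> mn; rewrite -(subnK mn); elim: (n - m)%N => [|k IH] //.
by rewrite addSn pS; lia.
Qed.

Lemma nu_le_mono (m n : nat) : (0 < m)%N -> (m <= n)%N -> (nu m <= nu n)%N.
Proof.
move=> m0 mn; rewrite -(subnK mn); elim: (n - m)%N => [|k IH] //.
by apply: leq_trans IH _; rewrite addSn; case: m m0 {mn} => // m _; rewrite addnS nu_leS.
Qed.

Lemma sub_p_nu (R : pzRingType) (n k : nat) : (k < n)%N ->
  (p (n - k.+1))%:R = (p (n - k))%:R - (nu (n - k))%:R :> R.
Proof.
move=> kn; have -> : (n - k = (n - k.+1).+1)%N by lia.
by rewrite pS natrD addrAC subrr add0r.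
Qed.

Lemma sum_nu (R : pzRingType) (n : nat) :
  \sum_(0 <= k < n.+1) (nu (n - k))%:R = (p n)%:R :> R.
Proof.
have S m : \sum_(0 <= k < m.+1) (nu k)%:R = (p m)%:R :> R.
  elim: m => [|m IH]; first by rewrite big_nat1 nu0 p0.
  by rewrite big_nat_recr //= IH pS natrD addrC.
by rewrite -(S n) [RHS]big_nat_rev /=; apply: eq_bigr => k _; rewrite add0n subSS.
Qed.

Lemma nu_recurrence (R : comPzRingType) (n : nat) : (0 < n)%N ->
  \sum_(1 <= k < n.+1) (sigma k)%:R * (nu (n - k))%:R =
  n%:R * (nu n)%:R + (p n.-1)%:R :> R.
Proof.
case: n => // n _; rewrite /=.
have -> : n.+1%:R * (nu n.+1)%:R + (p n)%:R = n.+1%:R * (p n.+1)%:R - n%:R * (p n)%:R :> R.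
  by rewrite pS natrD -[n.+1%:R]natr1; ring.
(* The top term [k = n.+1] has no partner in the sum for [n]; it agrees on both sides because
   [p 0 = nu 0 = 1]. *)
rewrite !p_recurrence big_nat_recr //= [X in _ = X - _]big_nat_recr //= !subnn p0 nu0 addrAC; congr (_ + _).
rewrite -sumrB !big_nat; apply: eq_bigr => k /andP[k0 kn].
by rewrite -mulrBr (subSn (n := n)) // pS natrD addrK.
Qed.

(** Bootstraps [p_recurrence] with [sigma k >= k]: [p >= 1] gives linear growth, and linear growth
    gives quadratic growth. This is just enough to absorb [sigma k <= k^2] in [sum_sigma_p_tail]. *)
Lemma p_quadratic (n : nat) : (n ^ 2 <= 12 * p n)%N.
Proof.
have rec (f : nat -> nat) : (forall m, f m <= 2 * p m)%N ->
    (\sum_(1 <= k < n.+1) k * f (n - k) <= 2 * (n * p n))%N.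
  move=> fp; rewrite -(ler_nat int) !natrM (p_recurrence int n) natr_sum mulr_sumr !big_nat.
  apply: ler_sum => k /andP[k0 kn]; rewrite -!natrM ler_nat.
  by have := fp (n - k)%N; have := sigma_ge k0; nia.
have lin m : (m.+1 <= 2 * p m)%N.
  case: m => [|m]; first by rewrite p0.
  have : (\sum_(1 <= k < m.+2) k <= m.+1 * p m.+1)%N.
    rewrite -(ler_nat int) natrM (p_recurrence int m.+1) natr_sum !big_nat.
    apply: ler_sum => k /andP[k0 kn]; rewrite -natrM ler_nat.
    by have := p_gt0 (m.+1 - k); have := sigma_ge k0; nia.
  have -> : (\sum_(1 <= k < m.+2) k = 'C(m.+2, 2))%N by rewrite -bin2_sum [RHS]big_ltn // add0n.
  have := mul_bin_diag m.+2 1; rewrite bin1 /=; nia.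
have := rec (fun m => m.+1) lin.
have S : (6 * \sum_(1 <= k < n.+1) k * (n - k).+1 = n * n.+1 * n.+2)%N.
  elim: n {rec} => [|m IH]; first by rewrite big_geq.
  rewrite big_nat_recr //= subnn.
  have -> : (\sum_(1 <= k < m.+1) k * (m.+1 - k).+1 =
    \sum_(1 <= k < m.+1) k * (m - k).+1 + \sum_(1 <= k < m.+1) k)%N.
    rewrite -big_split /= !big_nat; apply: eq_bigr => k kn; rewrite (subSn (n := m)); nia.
  have -> : (\sum_(1 <= k < m.+1) k = 'C(m.+1, 2))%N by rewrite -bin2_sum [RHS]big_ltn // add0n.
  have := mul_bin_diag m.+1 1; rewrite bin1 /=; nia.
by case: n S {rec} => // n S; nia.
Qed.

Lemma sigma_le (k : nat) : (sigma k <= k ^ 2)%N.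
Proof.
case: k => [|k]; first by rewrite /sigma big_geq.
by apply: leq_trans (sum_sigma_le k.+1); rewrite big_nat_recr //= leq_addl.
Qed.

(** These are the terms with [n - k < N], where a bound valid only from [N] on says nothing. Each is
    at most [n^2 p(N) <= 12 p(N) p(n)], and there are [N] of them. *)
Lemma sum_sigma_p_tail (R : realFieldType) (N : nat) : exists2 C : R, 0 <= C &
  forall n, (N <= n)%N ->
  \sum_(n - N + 1 <= k < n.+1) (sigma k)%:R * (p (n - k))%:R <= C * (p n)%:R.
Proof.
exists (N * (12 * p N))%:R => // n Nn.
apply: (@le_trans _ _ (\sum_(n - N + 1 <= k < n.+1) (12 * p N * p n)%:R)).
  rewrite !big_nat; apply: ler_sum => k /andP[k1 k2]; rewrite -natrM ler_nat.
  have : (p (n - k) <= p N)%N by apply: p_le_mono; lia.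
  have := sigma_le k; have := p_quadratic n.
  have : (k ^ 2 <= n ^ 2)%N by rewrite leq_exp2r.
  nia.
rewrite sumr_const_nat -[_%:R *+ _]mulr_natr -!natrM ler_nat.
have -> : (n.+1 - (n - N + 1) = N)%N by lia.
by nia.
Qed.

(** The sum of the [nu (n - k)], equal to [p n], is cut at [K]: the early terms are at most [nu n],
    and the later ones carry a weight at least [K] in [nu_recurrence]. With [K] near [sqrt n] this
    gives [p n = O(sqrt n * nu n)]. *)
Lemma p_le_nu (n K : nat) : (1 < K)%N -> (K <= n)%N ->
  (K * p n <= (K ^ 2 + n) * nu n)%N.
Proof.
move=> K0 Kn; have n0 : (0 < n)%N by lia.
(* Writing [p n.-1] as a sum of values of [nu] lowers every weight by one; [sigma k > k] for [k > 1]
   keeps [(sigma k).-1 >= k]. *)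
have W : (\sum_(1 <= k < n.+1) (sigma k).-1 * nu (n - k) = n * nu n)%N.
  have := nu_recurrence int n0; rewrite -[in X in _ + X](prednK n0) /=.
  have -> : (p n.-1)%:R = \sum_(1 <= k < n.+1) (nu (n - k))%:R :> int.
    by rewrite -(sum_nu _ n.-1) [RHS]big_add1 /= (prednK n0); apply: eq_bigr => k _; congr (nu _)%:R; lia.
  move/eqP; rewrite -subr_eq -sumrB -natrM => /eqP h.
  apply/eqP; rewrite -(eqr_nat int) -h natr_sum !big_nat; apply/eqP; apply: eq_bigr => k /andP[k0 _].
  by rewrite natrM -subn1 natrB ?mulrBl ?mul1r // (leq_trans k0 (sigma_ge k0)).
have T : (\sum_(0 <= k < n.+1) nu (n - k) = p n)%N.
  by apply/eqP; rewrite -(eqr_nat int) natr_sum sum_nu.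
rewrite -T (big_cat_nat (n := K)) //=; last by lia.
have A : (\sum_(0 <= k < K) nu (n - k) <= K * nu n)%N.
  rewrite -[X in (_ <= X * _)%N]subn0 -sum_nat_const_nat !big_nat.
  by apply: leq_sum => k /andP[_ kK]; apply: nu_le_mono; lia.
have B : (K * \sum_(K <= k < n.+1) nu (n - k) <= n * nu n)%N.
  rewrite -W [X in (_ <= X)%N](big_cat_nat (n := K)) //=; [|by lia|by lia].
  apply: leq_trans (leq_addl _ _); rewrite big_distrr /= !big_nat.
  apply: leq_sum => k /andP[Kk kn].
  by have := @sigma_gt k (leq_trans K0 Kk); nia.
nia.
Qed.

(** * Geometric comparison of [p (n - k)] with [p n] *)

Lemma ler_sum_nat_sub (R : numDomainType) (F : nat -> R) (m m' n' n : nat) :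
  (m <= m')%N -> (n' <= n)%N -> (forall k, (m <= k < n)%N -> 0 <= F k) ->
  \sum_(m' <= k < n') F k <= \sum_(m <= k < n) F k.
Proof.
move=> mm nn F0.
have [nm|nm] := leqP n' m'.
  by rewrite [leLHS]big_geq // big_nat; apply: sumr_ge0.
rewrite [leRHS](big_cat_nat (n := m')) //=; last by lia.
rewrite [X in _ + X](big_cat_nat (n := n')) //=; last by lia.
rewrite addrCA lerDl addr_ge0 // big_nat; apply: sumr_ge0 => k kn; apply: F0; lia.
Qed.

(** Unrolls [p (n - k - 1) = (1 - a) p (n - k) - E k] with excess [E k >= 0]; the total loss is at
    most the sum of the excesses. *)
Lemma p_shift_ge (R : realFieldType) (n K : nat) (a B : R) :
  (K <= n)%N -> 0 <= a <= 1 ->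
  (forall i, (i < K)%N -> a * (p (n - i))%:R <= (nu (n - i))%:R) ->
  \sum_(0 <= i < K) ((nu (n - i))%:R - a * (p (n - i))%:R) <= B * (p n)%:R ->
  forall k, (k <= K)%N -> ((1 - a) ^+ k - B) * (p n)%:R <= (p (n - k))%:R.
Proof.
move=> Kn /andP[a0 a1] aV EB.
pose E (i : nat) : R := (nu (n - i))%:R - a * (p (n - i))%:R.
have E0 i : (i < K)%N -> 0 <= E i by move=> iK; rewrite subr_ge0 aV.
have main k : (k <= K)%N ->
    (1 - a) ^+ k * (p n)%:R - \sum_(0 <= i < k) E i <= (p (n - k))%:R.
  elim: k => [|k IH] kK; first by rewrite big_geq // subr0 mul1r subn0.
  rewrite big_nat_recr //= sub_p_nu; last by lia.
  have S0 : 0 <= \sum_(0 <= i < k) E i.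
    by rewrite big_nat; apply: sumr_ge0 => i ik; apply: E0; lia.
  have := IH (ltnW kK); rewrite {3}/E exprS; nra.
move=> k kK; apply: le_trans (main k kK); rewrite mulrBl lerD2l lerN2.
by apply: le_trans EB; apply: ler_sum_nat_sub => // i iK; apply: E0; lia.
Qed.

(** [p_recurrence] is truncated at [K] and combined with [p_shift_ge]; the error [B] gets multiplied
    by a sum of [sigma], at most [K^2]. *)
Lemma n_ge_sum_sigma (R : realFieldType) (n K : nat) (a B : R) :
  (K <= n)%N -> 0 <= a <= 1 -> 0 <= B ->
  (forall i, (i < K)%N -> a * (p (n - i))%:R <= (nu (n - i))%:R) ->
  \sum_(0 <= i < K) ((nu (n - i))%:R - a * (p (n - i))%:R) <= B * (p n)%:R ->
  \sum_(1 <= k < K.+1) (sigma k)%:R * (1 - a) ^+ k - K%:R ^+ 2 * B <= n%:R.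
Proof.
move=> Kn a01 B0 aV EB.
have P0 : (0 : R) < (p n)%:R by rewrite ltr0n p_gt0.
rewrite -(ler_pM2r P0) p_recurrence.
apply: (@le_trans _ _ (\sum_(1 <= k < K.+1) (sigma k)%:R * (p (n - k))%:R)); last first.
  by apply: ler_sum_nat_sub => // k _; rewrite mulr_ge0.
apply: (@le_trans _ _ (\sum_(1 <= k < K.+1) (sigma k)%:R * (((1 - a) ^+ k - B) * (p n)%:R))).
  rewrite [leRHS](eq_bigr (fun k => (sigma k)%:R * (1 - a) ^+ k * (p n)%:R - (sigma k)%:R * (B * (p n)%:R))); last first.
    by move=> k _; rewrite mulrBl mulrBr mulrA.
  rewrite sumrB -!mulr_suml mulrBl lerD2l lerN2 -mulrA ler_wpM2r ?mulr_ge0 //.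
  by rewrite -natr_sum -natrX ler_nat sum_sigma_le.
rewrite !big_nat; apply: ler_sum => k kK; rewrite ler_wpM2l //.
by apply: (p_shift_ge Kn a01 aV EB); lia.
Qed.

(** Subtracting [a] times [p_recurrence] from [nu_recurrence] bounds the excesses weighted by
    [sigma], and [sigma i >= J] from [J] on. The first [J] excesses are simply bounded by [nu n]. *)
Lemma sum_excess_le (R : realFieldType) (n N J K : nat) (a C : R) :
  (0 < N)%N -> (0 < J)%N -> (J <= K)%N -> (K + N <= n)%N -> 0 <= a ->
  \sum_(n - N + 1 <= k < n.+1) (sigma k)%:R * (p (n - k))%:R <= C * (p n)%:R ->
  (forall m, (N <= m <= n)%N -> a * (p m)%:R <= (nu m)%:R) ->
  J%:R * \sum_(0 <= i < K) ((nu (n - i))%:R - a * (p (n - i))%:R) <=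
  J%:R ^+ 2 * (nu n)%:R + n%:R * ((nu n)%:R - a * (p n)%:R) + (1 + a * C) * (p n)%:R.
Proof.
move=> N0 J0 JK KN a0 tail aV.
pose E (i : nat) : R := (nu (n - i))%:R - a * (p (n - i))%:R.
have E0 i : (i <= n - N)%N -> 0 <= E i by move=> iN; rewrite subr_ge0 aV //; lia.
rewrite -/E (big_cat_nat (n := J)) //= mulrDr -addrA lerD //.
  rewrite expr2 -mulrA ler_wpM2l // mulrC mulr_natr.
  rewrite -[X in _ *+ X]subn0 -sumr_const_nat !big_nat; apply: ler_sum => i iJ.
  apply: (@le_trans _ _ (nu (n - i))%:R); first by rewrite gerBl mulr_ge0.
  by rewrite ler_nat; apply: nu_le_mono; lia.
have T : \sum_(1 <= k < n.+1) (sigma k)%:R * E k = n%:R * ((nu n)%:R - a * (p n)%:R) + (p n.-1)%:R.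
  have n0 : (0 < n)%N by lia.
  rewrite mulrBr addrAC -nu_recurrence // mulrCA p_recurrence mulr_sumr -sumrB.
  by apply: eq_bigr => k _; rewrite /E; ring.
have U : \sum_(1 <= k < n - N + 1) (sigma k)%:R * E k <=
    n%:R * ((nu n)%:R - a * (p n)%:R) + (1 + a * C) * (p n)%:R.
  have pn : (p n.-1)%:R <= (p n)%:R :> R by rewrite ler_nat p_le_mono // leq_pred.
  move: T; rewrite (big_cat_nat (n := (n - N + 1)%N)) //=; [|by lia|by lia] => T.
  (* Beyond [n - N] the excess may be negative, but it is at least [- a p], which [tail]
     controls. *)
  have : - (a * \sum_(n - N + 1 <= k < n.+1) (sigma k)%:R * (p (n - k))%:R) <=
     \sum_(n - N + 1 <= k < n.+1) (sigma k)%:R * E k.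
    rewrite mulr_sumr -sumrN; apply: ler_sum => k _.
    rewrite /E mulrBr mulrCA lerDr mulr_ge0 //.
  have := ler_wpM2l a0 tail.
  by move: T; lra.
apply: le_trans U.
apply: (@le_trans _ _ (\sum_(J <= i < K) (sigma i)%:R * E i)).
  rewrite mulr_sumr !big_nat; apply: ler_sum => i iJK; rewrite ler_wpM2r ?E0 //; first by lia.
  by rewrite ler_nat (leq_trans _ (@sigma_ge i _)) //; lia.
by apply: ler_sum_nat_sub => [//||k kn]; [lia|rewrite mulr_ge0 // E0 //; lia].
Qed.

Lemma p_shift_le (R : realFieldType) (n N K k : nat) (a : R) :
  0 <= a <= 1 -> (K <= k)%N -> (k + N <= n)%N ->
  (forall m, (N <= m <= n)%N -> a * (p m)%:R <= (nu m)%:R) ->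
  (p (n - k))%:R <= (1 - a) ^+ (k - K) * (p (n - K))%:R.
Proof.
move=> /andP[a0 a1] Kk kN aV; elim: k Kk kN => [|k IH] Kk kN.
  by move: Kk; rewrite leqn0 => /eqP->; rewrite subn0 mul1r.
move: Kk; rewrite leq_eqVlt => /orP[/eqP->|Kk]; first by rewrite subnn mul1r.
rewrite ltnS in Kk; rewrite sub_p_nu ?subSn //; last by lia.
have h : a * (p (n - k))%:R <= (nu (n - k))%:R by apply: aV; lia.
have kN' : (k + N <= n)%N by lia.
have a1' : 0 <= 1 - a by rewrite subr_ge0.
have := ler_wpM2l a1' (IH Kk kN').
by rewrite exprS -mulrA; apply: le_trans; rewrite mulrBl mul1r lerD2l lerN2.
Qed.

(** A defect of [p (n - K)] against [(1 - a)^K p(n)] persists for the later [k]. Weighted by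
    [sigma k >= k], the total defect is at most [p n] times the gap between the Lambert bound
    [zeta2 / a^2] and [n], up to the tail [C]. *)
Lemma p_defect_le (R : realType) (n N K M : nat) (a C : R) :
  (0 < K)%N -> (M + N <= n)%N -> 0 < a < 1 ->
  \sum_(n - N + 1 <= k < n.+1) (sigma k)%:R * (p (n - k))%:R <= C * (p n)%:R ->
  (forall m, (N <= m <= n)%N -> a * (p m)%:R <= (nu m)%:R) -> (K <= M)%N ->
  ((1 - a) ^+ K * (p n)%:R - (p (n - K))%:R) * (\sum_(K <= k < M.+1) k%:R * (1 - a) ^+ k) <=
  (zeta2 / a ^+ 2 - n%:R + C) * (p n)%:R.
Proof.
move=> K0 MN a01 tail aV KM; move: (a01) => /andP[a0 a1].
have a01' : 0 <= a <= 1 by rewrite !ltW.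
have x01 : 0 <= 1 - a < 1 by rewrite subr_ge0 ltW // gtrBl.
have x0 : 0 <= 1 - a by case/andP: x01.
have x1 : 1 - a <= 1 by case/andP: x01 => _ /ltW.
have S := sum_sigma_exp_le (n - N) x01; rewrite subKr in S.
have P0 : (0 : R) <= (p n)%:R by [].
have le0 k : (k + N <= n)%N -> (p (n - k))%:R <= (1 - a) ^+ k * (p n)%:R.
  by move=> kN; have := p_shift_le a01' (leq0n k) kN aV; rewrite !subn0.
set g := _ - (p (n - K))%:R.
have g0 : 0 <= g by rewrite subr_ge0 le0 //; clear -MN KM; lia.
have D : g * (\sum_(K <= k < M.+1) k%:R * (1 - a) ^+ k) <=
   \sum_(1 <= k < n - N + 1) ((sigma k)%:R * (1 - a) ^+ k * (p n)%:R - (sigma k)%:R * (p (n - k))%:R).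
  apply: (@le_trans _ _ (\sum_(K <= k < M.+1) ((sigma k)%:R * (1 - a) ^+ k * (p n)%:R - (sigma k)%:R * (p (n - k))%:R))); last first.
    apply: ler_sum_nat_sub => [//||k kn]; first by clear -MN; lia.
    by rewrite -mulrA -mulrBr mulr_ge0 // subr_ge0 le0 //; clear -MN kn; lia.
  rewrite mulr_sumr !big_nat; apply: ler_sum => k kKM.
  rewrite -mulrA -mulrBr mulrCA; apply: ler_pM => //; first by rewrite mulr_ge0 // exprn_ge0.
    by rewrite ler_nat sigma_ge //; clear -K0 kKM; lia.
  have Kk : (K <= k)%N by case/andP: kKM.
  have kN : (k + N <= n)%N by clear -MN kKM; lia.
  have := p_shift_le a01' Kk kN aV.
  have -> : (p (n - K))%:R = (1 - a) ^+ K * (p n)%:R - g by rewrite subKr.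
  rewrite mulrBr mulrA -exprD subnK // lerBrDl => h.
  rewrite mulrC; apply: (@le_trans _ _ ((1 - a) ^+ (k - K) * g)); last by rewrite lerBrDl; lra.
  by rewrite ler_wpM2r // ler_wiXn2l // leq_subr.
apply: (le_trans D); rewrite sumrB -mulr_suml.
have := p_recurrence R n; rewrite (big_cat_nat (n := (n - N + 1)%N)) //=; [|by clear -MN; lia|by clear -MN; lia] => T.
have := ler_wpM2r P0 S; rewrite -[(n - N).+1]addn1 => S'.
rewrite mulrDl mulrBl; move: S' tail T; lra.
Qed.

(** * Asymptotics *)

Lemma nat_floor (R : archiRealFieldType) (x : R) : 0 <= x -> exists K : nat, K%:R <= x < K%:R + 1.
Proof. by move=> x0; exists (Num.truncn x); rewrite natr1 truncn_itv. Qed.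

Lemma near_sqrt_ge (R : realType) (x : R) : \forall n \near \oo, x <= Num.sqrt n%:R :> R.
Proof.
have [K /andP[_ Kx]] := nat_floor (normr_ge0 x).
near=> n.
have Kn : (K.+1 ^ 2 <= n)%N by near: n; exact: nbhs_infty_ge.
apply: (@le_trans _ _ K.+1%:R).
  by apply: le_trans (ler_norm x) _; rewrite -natr1 ltW.
rewrite -[leLHS]ger0_norm // -sqrtr_sqr ler_wsqrtr // -natrX ler_nat.
exact: Kn.
Unshelve. all: by end_near. Qed.

Lemma near_infty_nat (P : nat -> Prop) :
  (\forall n \near \oo, P n) -> exists N, forall n, (N <= n)%N -> P n.
Proof. by move=> [N _ NP]; exists N => n Nn; apply: NP. Qed.

(** * Lower bound for [nu] *)

Lemma nu_lower_apriori (R : realType) :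
  \forall n \near \oo, 4^-1 * (p n)%:R <= Num.sqrt n%:R * (nu n)%:R :> R.
Proof.
near=> n.
have r2 : 2 <= Num.sqrt n%:R :> R by near: n; exact: near_sqrt_ge.
have rr : (n%:R : R) = Num.sqrt n%:R ^+ 2 by rewrite sqr_sqrtr.
move: (Num.sqrt n%:R) r2 rr => r r2 rr.
have r0 : 0 <= r by lra.
(* [K] is [sqrt n] rounded down, so [K >= r / 2] and [K^2 + n <= 2 n] in [p_le_nu], whence the
   constant [1/4]. *)
have [K /andP[Kr rK]] := nat_floor r0.
have K1 : (1 < K)%N by rewrite -(ltr_nat R); lra.
have Kn : (K <= n)%N by rewrite -(ler_nat R) rr; nra.
have := p_le_nu K1 Kn; rewrite -(ler_nat R) !natrM natrD natrX rr => h.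
have V0 : 0 <= (nu n)%:R :> R by []; have P0 : 0 <= (p n)%:R :> R by [].
move: (p n)%:R (nu n)%:R V0 P0 h => P V V0 P0 h.
have K0 : 0 <= K%:R :> R by [].
have h1 : (K%:R ^+ 2 + r ^+ 2) * V <= 2 * r ^+ 2 * V by rewrite ler_wpM2r //; nra.
have h2 : r / 2 * P <= K%:R * P by rewrite ler_wpM2r //; lra.
have : r * (4^-1 * P) <= r * (r * V) by nra.
by rewrite ler_pM2l //; lra.
Unshelve. all: by end_near. Qed.

Lemma zeta2_approx (R : realType) (t : R) : t < zeta2 -> exists J, t < inv_squares R J.
Proof.
move=> tz; have pi0 : 0 < (pi : R) ^+ 2 / 4 by rewrite divr_gt0 ?exprn_gt0 ?pi_gt0.
have d0 : 0 < zeta2 - t by rewrite subr_gt0.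
have [m /andP[_ hm]] := nat_floor (ltW (divr_gt0 pi0 d0)).
exists (2 ^ m)%N; apply: lt_le_trans (inv_squares_ge R m).
rewrite ltrBrDl -ltrBrDr -/zeta2 ltr_pdivrMr ?exprn_gt0 //.
move: hm; rewrite ltr_pdivrMr // => /lt_le_trans -> //.
rewrite mulrC ler_pM2l // natr1 -natrX ler_nat ltn_expl //.
Qed.

Lemma zeta2_ge1 (R : realType) : 1 <= zeta2 :> R.
Proof. by have := inv_squares_le R 1; rewrite /inv_squares big_nat1 expr1n invr1. Qed.

Lemma zeta2_le4 (R : realType) : zeta2 <= 4 :> R.
Proof.
rewrite /zeta2; have := pihalf_lt2 R; have := pi_gt0 R; move: (pi : R) => q q0 q4.
by nra.
Qed.

Lemma nat_above (R : archiRealFieldType) (x : R) : exists2 T : nat, (0 < T)%N & x <= T%:R.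
Proof.
have [K /andP[_ h]] := nat_floor (normr_ge0 x).
by exists K.+1 => //; apply: le_trans (ler_norm x) _; rewrite -natr1 ltW.
Qed.

Lemma leq_doubled_trunc_div (K q : nat) : (0 < q)%N -> (q <= K)%N ->
  (K <= 2 * (K %/ q * q))%N.
Proof.
move=> q0 qK; have := ltn_ceil K q0; have : (0 < K %/ q)%N by rewrite divn_gt0.
by move: (K %/ q)%N => j j0; rewrite mulSn; nia.
Qed.

Lemma floor_div_bounds (R : archiRealFieldType) (r : R) (q : nat) :
  (0 < q)%N -> 2 * q%:R + 2 <= r -> exists K j : nat,
  [/\ K%:R <= r < K%:R + 1, (0 < j <= K)%N & j%:R * q%:R <= r <= 4 * (j%:R * q%:R)].
Proof.
move=> q0 qr; have q0' : (0 : R) < q%:R by rewrite ltr0n.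
have r0 : 0 <= r by lra.
have [K /andP[Kr rK]] := nat_floor r0; exists K, (K %/ q)%N.
have Kq : (q <= K)%N by rewrite -(ler_nat R); lra.
split; [by rewrite Kr|by rewrite divn_gt0 // Kq leq_div|].
have := leq_trunc_div K q; have := leq_doubled_trunc_div q0 Kq.
rewrite -!(ler_nat R) !natrM => h1 h2.
have q1 : 1 <= q%:R :> R by rewrite ler1n.
by apply/andP; split; lra.
Qed.

(** This is [sum_excess_le] divided by [j], which is of order [r / q]. The bound becomes small by
    taking first [q] large, then [e] small, then [r] large. *)
Lemma excess_density_le (R : realFieldType) (n N j q K : nat) (r l e C : R) :
  (0 < N)%N -> (0 < j)%N -> (j <= K)%N -> (K + N <= n)%N -> (0 < q)%N ->
  0 < r -> n%:R = r ^+ 2 -> 0 <= l - e <= r -> 0 <= C ->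
  j%:R * q%:R <= r <= 4 * (j%:R * q%:R) ->
  \sum_(n - N + 1 <= k < n.+1) (sigma k)%:R * (p (n - k))%:R <= C * (p n)%:R ->
  (forall m, (N <= m <= n)%N -> (l - e) / r * (p m)%:R <= (nu m)%:R) ->
  r * (nu n)%:R <= (l + e) * (p n)%:R ->
  0 <= e ->
  \sum_(0 <= i < K) ((nu (n - i))%:R - (l - e) / r * (p (n - i))%:R) <=
  ((l + e) / q%:R + 4 * q%:R * (2 * e + (1 + C) / r)) * (p n)%:R.
Proof.
move=> N0 j0 jK KN q0 r0 nr /andP[le0 ler] C0 /andP[jq rjq] tail aV hV e0.
have a0 : 0 <= (l - e) / r by rewrite divr_ge0 // ltW.
have a1 : (l - e) / r <= 1 by rewrite ler_pdivrMr // mul1r.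
have := sum_excess_le N0 j0 jK KN a0 tail aV; rewrite nr; set S := \sum_(_ <= _ < _) _ => h.
have j0' : (0 : R) < j%:R by rewrite ltr0n.
have q0' : (0 : R) < q%:R by rewrite ltr0n.
have V0 : 0 <= (nu n)%:R :> R by []; have P0 : 0 <= (p n)%:R :> R by [].
rewrite -(ler_pM2l j0'); apply: (le_trans h) => {h tail aV}.
move: S => _; move: (p n)%:R (nu n)%:R P0 V0 hV => P V P0 V0 hV.
have E1 : j%:R ^+ 2 * V <= j%:R * ((l + e) / q%:R) * P.
  rewrite expr2 -!mulrA ler_pM2l // mulrA mulrAC ler_pdivlMr //.
  by apply: le_trans hV; rewrite mulrAC ler_wpM2r.
have E2 : r ^+ 2 * (V - (l - e) / r * P) <= 2 * e * (r * P).
  have -> : r ^+ 2 * (V - (l - e) / r * P) = r * (r * V) - r * (l - e) * P.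
    by field; rewrite gt_eqF.
  have := ler_wpM2l (ltW r0) hV; lra.
have E3 : (1 + (l - e) / r * C) * P <= (1 + C) * P.
  by rewrite ler_wpM2r // lerD2l ler_piMl.
have E4 : 2 * e * (r * P) + (1 + C) * P = r * ((2 * e + (1 + C) / r) * P).
  by field; rewrite gt_eqF.
have E5 : r * ((2 * e + (1 + C) / r) * P) <= 4 * (j%:R * q%:R) * ((2 * e + (1 + C) / r) * P).
  rewrite ler_wpM2r // mulr_ge0 //; apply: addr_ge0; first exact: mulr_ge0.
  by apply: divr_ge0; [exact: addr_ge0|exact: ltW].
lra.
Qed.

Lemma leq_sub_range (K N n i : nat) : (K + N <= n)%N -> (i < K)%N -> (N <= n - i <= n)%N.
Proof. lia. Qed.

(** The surplus [1 + 4 c] of [Z] over [l^2] drops to [1 + 2 c] after the truncation factor and to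
    [1 + c] after the factor [1 - j a], still above [1 + x]. *)
Lemma lambert_contradiction (R : realFieldType) (c l e r Z w j x : R) :
  0 < c -> 0 < l -> 0 < e -> e <= l / 2 -> 0 < r -> 0 <= j -> 0 < w ->
  Z = (1 + 4 * c) * l ^+ 2 -> (1 + 4 * c) / c <= w -> j * l * (1 + 2 * c) / c <= r -> x < c ->
  (1 - j * ((l - e) / r)) * (1 - 2 / (1 + w)) * Z / ((l - e) / r) ^+ 2 <= r ^+ 2 * (1 + x) ->
  False.
Proof.
move=> c0 l0 e0 el r0 j0 w0 ZE wc jr xc.
have le0 : 0 < l - e by lra.
set a := (l - e) / r.
have a0 : 0 < a by rewrite divr_gt0.
have F1 : 1 + 2 * c <= (1 - 2 / (1 + w)) * (1 + 4 * c).
  have w1 : 0 < 1 + w by lra.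
  have : 2 / (1 + w) * (1 + 4 * c) <= 2 * c.
    rewrite mulrAC ler_pdivrMr //.
    have : (1 + 4 * c) / c <= 1 + w by lra.
    by rewrite ler_pdivrMr //; lra.
  lra.
have Ja : 1 + c <= (1 - j * a) * (1 + 2 * c).
  have : j * a * (1 + 2 * c) <= c.
    rewrite /a mulrA mulrAC ler_pdivrMr //.
    move: jr; rewrite ler_pdivrMr // [r * c]mulrC; apply: le_trans; rewrite ler_wpM2r //; first lra.
    by rewrite ler_wpM2l //; lra.
  lra.
have Ja0 : 0 <= 1 - j * a.
  have h : 0 <= (1 - j * a) * (1 + 2 * c) by lra.
  by move: h; rewrite pmulr_lge0 //; lra.
have F0 : 0 <= 1 - 2 / (1 + w).
  have h : 0 <= (1 - 2 / (1 + w)) * (1 + 4 * c) by lra.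
  by move: h; rewrite pmulr_lge0 //; lra.
have Za : (1 + 4 * c) * r ^+ 2 <= Z / a ^+ 2.
  rewrite ler_pdivlMr ?exprn_gt0 // ZE -mulrA ler_wpM2l //; first lra.
  have -> : r ^+ 2 * a ^+ 2 = (l - e) ^+ 2 by rewrite /a; field; rewrite gt_eqF.
  by rewrite lerXn2r ?nnegrE; lra.
move=> h.
have : r ^+ 2 * (1 + c) <= r ^+ 2 * (1 + x).
  apply: le_trans h; rewrite -mulrA.
  apply: (@le_trans _ _ ((1 - j * a) * (1 - 2 / (1 + w)) * ((1 + 4 * c) * r ^+ 2))).
    rewrite mulrA mulrC ler_wpM2r ?sqr_ge0 // -mulrA; apply: (le_trans Ja); exact: ler_wpM2l.
  by rewrite ler_wpM2l // mulr_ge0.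
by rewrite ler_pM2l ?exprn_gt0 //; lra.
Qed.

Lemma nu_lower_improve (R : realType) (l : R) : 0 < l -> l ^+ 2 < zeta2 ->
  (forall e, 0 < e -> \forall n \near \oo, (l - e) * (p n)%:R <= Num.sqrt n%:R * (nu n)%:R) ->
  exists2 d, 0 < d & \forall n \near \oo, (l + d) * (p n)%:R <= Num.sqrt n%:R * (nu n)%:R.
Proof.
move=> l0 lz low.
have [J lJ] := zeta2_approx lz; set Z := inv_squares R J in lJ.
have J0 : (0 < J)%N.
  rewrite lt0n; apply/negP => /eqP J0; move: lJ; rewrite /Z J0 /inv_squares big_geq //.
  by have := sqr_ge0 l; lra.
(* [4 c] is the relative surplus of [Z] over [l^2], to be spent in [lambert_contradiction]. *)
pose c := (Z / l ^+ 2 - 1) / 4.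
have c0 : 0 < c by rewrite divr_gt0 // subr_gt0 ltr_pdivlMr ?exprn_gt0 // mul1r.
have ZE : Z = (1 + 4 * c) * l ^+ 2 by rewrite /c; field; rewrite gt_eqF.
(* [T * K0] will be the truncation length in [sum_sigma_exp_ge]; this [T] makes its product with [a]
   at least [(1 + 4 c) / c]. *)
have [T T0 hT] := nat_above (4 * ((1 + 4 * c) / c) / l).
have T0' : (0 : R) < T%:R by rewrite ltr0n.
have wT : (1 + 4 * c) / c <= T%:R * l / 4.
  by move: hT; rewrite ler_pdivrMr //; lra.
have w4 : 4 < T%:R * l / 4.
  by apply: lt_le_trans wT; rewrite ltr_pdivlMr //; lra.
(* [D] bounds [K^2 / n], so the error [K^2 B] is at most [D B n]. *)
pose D : R := (2 * T%:R * J%:R) ^+ 2.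
have D0 : 0 < D by rewrite exprn_gt0 // !mulr_gt0 // ltr0n.
have [q q0 hq] := nat_above (8 * D * l / c).
have q0' : (0 : R) < q%:R by rewrite ltr0n.
have Dq : D * (2 * l / q%:R) <= c / 4.
  rewrite mulrA ler_pdivrMr //; move: hq; rewrite ler_pdivrMr //; lra.
pose e := Num.min (l / 2) (c / (64 * D * q%:R)).
have Dq0 : 0 < 64 * D * q%:R by apply: mulr_gt0 => //; apply: mulr_gt0.
have e0 : 0 < e by rewrite lt_min; apply/andP; split; [lra|exact: divr_gt0].
have el : e <= l / 2 by rewrite ge_min lexx.
have De : D * (4 * q%:R * (2 * e)) <= c / 8.
  have : e <= c / (64 * D * q%:R) by rewrite ge_min lexx orbT.
  by rewrite ler_pdivlMr //; lra.
(* The gain is the slack itself: if the ratio at [n] stays below [l + e], its excess over [l - e] is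
   less than [2 e]. *)
exists e => //.
have [N1 hN1] := near_infty_nat (low e e0).
pose N := N1.+1; have [C C0 tail] := sum_sigma_p_tail R N.
near=> n.
have rl : l + 1 <= Num.sqrt n%:R by near: n; exact: near_sqrt_ge.
have rN : N%:R <= Num.sqrt n%:R :> R by near: n; exact: near_sqrt_ge.
have rq : 2 * q%:R + 2 <= Num.sqrt n%:R :> R by near: n; exact: near_sqrt_ge.
have rTJ : 2 * T%:R * J%:R + 1 <= Num.sqrt n%:R :> R by near: n; exact: near_sqrt_ge.
have rJ : J%:R * l * (1 + 2 * c) / c <= Num.sqrt n%:R by near: n; exact: near_sqrt_ge.
have rC : 16 * D * q%:R * (1 + C) / c <= Num.sqrt n%:R by near: n; exact: near_sqrt_ge.
rewrite leNgt; apply/negP => hV.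
set r := Num.sqrt n%:R in hV rl rN rq rTJ rJ rC.
have nr : n%:R = r ^+ 2 by rewrite sqr_sqrtr.
have r0 : 0 < r by lra.
have [K0 [j [/andP[K0r rK0] /andP[j0 jK0] jqr]]] := floor_div_bounds q0 rq.
pose K := ((T * K0).*2 * J)%N.
have KE : K%:R = 2 * T%:R * J%:R * K0%:R :> R by rewrite /K -muln2 !natrM; ring.
have Kr : K%:R <= 2 * T%:R * J%:R * r.
  by rewrite KE ler_wpM2l // !mulr_ge0.
have jK : (j <= K)%N.
  apply: leq_trans jK0 _; rewrite /K -muln2 -!mulnA mulnCA leq_pmulr //.
  by rewrite !muln_gt0 T0 J0.
have KN : (K + N <= n)%N.
  rewrite -(ler_nat R) natrD nr expr2; apply: le_trans (lerD Kr rN) _.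
  by rewrite -[X in _ + X]mul1r -mulrDl ler_wpM2r // ltW.
pose a := (l - e) / r.
have a0 : 0 < a by rewrite divr_gt0 //; lra.
have a1 : a < 1 by rewrite ltr_pdivrMr // mul1r; lra.
(* Since [sqrt m <= sqrt n], the bound at [m] holds with the common constant [a] taken at [n]. *)
have aV m : (N <= m <= n)%N -> a * (p m)%:R <= (nu m)%:R.
  move=> /andP[Nm mn]; rewrite /a mulrAC ler_pdivrMr //.
  apply: le_trans (hN1 m (ltnW Nm)) _; rewrite mulrC ler_wpM2l //.
  by rewrite ler_wsqrtr // ler_nat.
have Nn : (N <= n)%N by exact: leq_trans (leq_addl _ _) KN.
have ler' : 0 <= l - e <= r by apply/andP; split; lra.
have SB := excess_density_le (isT : (0 < N)%N) j0 jK KN q0 r0 nr ler' C0 jqr (tail n Nn) aV (ltW hV) (ltW e0).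
set B := (l + e) / q%:R + 4 * q%:R * (2 * e + (1 + C) / r) in SB.
have B0 : 0 <= B.
  apply: addr_ge0; first by apply: divr_ge0; [apply: addr_ge0; exact: ltW|].
  apply: mulr_ge0; first exact: mulr_ge0.
  apply: addr_ge0; first by apply: mulr_ge0 => //; exact: ltW.
  by apply: divr_ge0; [exact: addr_ge0|exact: ltW].
have Kn : (K <= n)%N by exact: leq_trans (leq_addr _ _) KN.
have a01 : 0 <= a <= 1 by rewrite !ltW.
have aV' i : (i < K)%N -> a * (p (n - i))%:R <= (nu (n - i))%:R.
  by move=> iK; apply: aV; exact: leq_sub_range KN iK.
have up := n_ge_sum_sigma Kn a01 B0 aV' SB.
have Na : T%:R * l / 4 <= (T * K0)%:R * a.
  rewrite natrM /a mulrA ler_pdivlMr //.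
  have : r / 2 * (l / 2) <= K0%:R * (l - e) by apply: ler_pM; clear -r0 l0 el rq rK0 q0'; lra.
  by move=> /(ler_wpM2l (ltW T0')); lra.
have Na1 : 1 <= (T * K0)%:R * a by lra.
have a01s : 0 < a < 1 by rewrite a0.
have lo := sum_sigma_exp_ge a01s (leqnn K) Na1.
have lo2 := le_trans lo (_ : _ <= n%:R + K%:R ^+ 2 * B).
have {lo2} lo3 := lo2 ltac:(by rewrite -lerBlDr).
rewrite nr -/Z in lo3.
have KB : K%:R ^+ 2 * B <= D * r ^+ 2 * B.
  by rewrite ler_wpM2r // /D -exprMn lerXn2r ?nnegrE ?mulr_ge0 ?(ltW r0).
(* The three parts of [B] cost [c / 4], [c / 8] and [c / 4]. *)
have DB : D * B < c.
  have h1 : D * ((l + e) / q%:R) <= c / 4.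
    by apply: le_trans Dq; rewrite ler_pM2l // ler_pM2r ?invr_gt0 //; lra.
  have h2 : D * (4 * q%:R * ((1 + C) / r)) <= c / 4.
    rewrite !mulrA ler_pdivrMr //; move: rC; rewrite ler_pdivrMr //; lra.
  by rewrite /B; lra.
have w0 : 0 < (T * K0)%:R * a by exact: lt_le_trans ltr01 Na1.
apply: (lambert_contradiction c0 l0 e0 el r0 (ler0n _ J) w0 ZE (le_trans wT Na) rJ DB).
apply: (le_trans lo3); rewrite [leRHS]mulrDr mulr1 lerD2l [leRHS]mulrA [r ^+ 2 * D]mulrC; exact: KB.
Unshelve. all: by end_near. Qed.

(** The supremum of the admissible constants acts as the lower limit; [nu_lower_apriori] makes it
    positive and [nu_lower_improve] excludes a value below [c]. *)
Lemma nu_lower (R : realType) (l : R) : l < Num.sqrt zeta2 ->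
  \forall n \near \oo, l * (p n)%:R <= Num.sqrt n%:R * (nu n)%:R.
Proof.
move=> lc; set c := Num.sqrt zeta2 in lc.
have z0 : 0 <= zeta2 :> R by apply: le_trans ler01 (zeta2_ge1 R).
have c1 : 1 <= c by rewrite -sqrtr1 ler_wsqrtr // zeta2_ge1.
have c2 : c ^+ 2 = zeta2 by rewrite sqr_sqrtr.
(* The cap [a <= c] guarantees that the supremum exists. *)
pose S := [set a : R | a <= c /\ \forall n \near \oo, a * (p n)%:R <= Num.sqrt n%:R * (nu n)%:R].
have S4 : S 4^-1 by split; [lra|exact: nu_lower_apriori].
have Sdown a b : a <= b -> S b -> S a.
  move=> ab [bc hb]; split; first exact: le_trans ab bc.
  by near=> n; apply: (@le_trans _ _ (b * (p n)%:R)); [rewrite ler_wpM2r|near: n].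
have Sub : ubound S c by move=> a [].
have hS : has_sup S by split; [exists 4^-1|exists c].
have s4 : 4^-1 <= sup S by apply: ub_le_sup => //; exists c.
have sc : sup S <= c by apply: ge_sup => //; exists 4^-1.
have low e : 0 < e -> S (sup S - e).
  move=> e0; have [b Sb hb] := sup_adherent e0 hS.
  by apply: (Sdown _ b) => //; exact: ltW.
have [cs|cs] := leP c (sup S).
  have lS : 0 < c - l by lra.
  have [_] := low _ lS; have -> : sup S = c by apply/eqP; rewrite eq_le sc cs.
  by rewrite subKr.
have l0 : 0 < sup S by lra.
have lz : sup S ^+ 2 < zeta2.
  by rewrite -c2 ltrXn2r ?nnegrE //; lra.
have [d d0 hd] := nu_lower_improve l0 lz (fun e e0 => (low e e0).2).
pose d' := Num.min d (c - sup S).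
have d'0 : 0 < d' by rewrite lt_min d0 subr_gt0.
have : S (sup S + d').
  split; first by rewrite -lerBrDl ge_min lexx orbT.
  near=> n; apply: (@le_trans _ _ ((sup S + d) * (p n)%:R)); last by near: n.
  by rewrite ler_wpM2r // lerD2l ge_min lexx.
move=> /(ub_le_sup (ex_intro _ c Sub)); lra.
Unshelve. all: by end_near. Qed.

(** * Upper bound for [nu] *)

Lemma mul_nu_le (m K : nat) : (0 < m)%N -> (K * nu m + p m <= p (m + K))%N.
Proof.
move=> m0; elim: K => [|K IH]; first by rewrite addn0.
rewrite addnS pS mulSn -addnA leq_add // nu_le_mono //.
exact: leqW (leq_addr _ _).
Qed.

(** With [n = m + K], [p_defect_le] bounds [p n - p m] by [(K a + rho) p(n)], while monotonicity of
    [nu] makes it at least [K nu(m)]. As [K] is of order [r / q], multiplying by [r / K] turns [rho]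
    into at most [8 q rho]. *)
Lemma nu_upper_step (R : realType) (m N K q : nat) (r c e C t rho : R) :
  (0 < N)%N -> (N <= m)%N -> (0 < K)%N -> (16 <= q)%N ->
  0 < r -> (m + K)%:R = r ^+ 2 -> r <= 8 * (K%:R * q%:R) -> K%:R * q%:R <= r ->
  r / 4 + N%:R <= r ^+ 2 -> 16 <= r ->
  1 <= c <= 2 -> c ^+ 2 = zeta2 -> 0 < e <= 2^-1 -> 0 <= C ->
  16 * e + C / r ^+ 2 <= t -> rho = 256 * t ->
  \sum_(m + K - N + 1 <= k < (m + K).+1) (sigma k)%:R * (p (m + K - k))%:R <= C * (p (m + K))%:R ->
  (forall i, (N <= i <= m + K)%N -> (c - e) / r * (p i)%:R <= (nu i)%:R) ->
  (1 - c / q%:R - rho) * (r * (nu m)%:R) <= (c + 8 * q%:R * rho) * (p m)%:R.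
Proof.
move=> N0 Nm K0 q8 r0 nr rKq Kqr rN r16 /andP[c1 c2] cz /andP[e0 e2] C0 tE rhoE tail aV.
set n := (m + K)%N in nr tail aV.
have rho0 : 0 <= rho.
  rewrite rhoE; apply: mulr_ge0 => //; apply: le_trans tE; apply: addr_ge0.
    by apply: mulr_ge0 => //; exact: ltW.
  by apply: divr_ge0 => //; exact: sqr_ge0.
have A0 : 0 <= c + 8 * q%:R * rho.
  apply: addr_ge0; first exact: le_trans ler01 c1.
  by apply: mulr_ge0 => //; exact: mulr_ge0.
pose a := (c - e) / r.
have q8' : 16 <= q%:R :> R by rewrite ler_nat.
have K0' : 1 <= K%:R :> R by rewrite ler1n.
have a0 : 0 < a by rewrite divr_gt0 //; lra.
have a1 : a < 1 by rewrite ltr_pdivrMr // mul1r; lra.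
have ar : a * r = c - e by rewrite divfK // gt_eqF.
have a01 : 0 < a < 1 by rewrite a0.
have a01' : 0 <= a <= 1 by rewrite !ltW.
have r4 : 0 <= r / 4 by lra.
have r8 : 0 <= r / 8 by lra.
(* For [k] between [r / 8] and [r / 4] one has [k a <= 1/2], so [k (1 - a)^k >= r / 16], and there
   are at least [r / 16] such [k]: hence [r^2 / 256] and the factor in [rho = 256 t]. *)
have [M /andP[Mr rM]] := nat_floor r4.
have [H /andP[Hr rH]] := nat_floor r8.
have KH : (K <= H.+1)%N.
  have : K%:R * 16 <= K%:R * q%:R :> R by rewrite ler_wpM2l.
  by rewrite -(ler_nat R) -natr1; lra.
have HM : (H.+1 <= M)%N by rewrite -(ler_nat R) -natr1; lra.
have KM : (K <= M)%N by exact: leq_trans KH HM.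
have MN : (M + N <= n)%N by rewrite -(ler_nat R) natrD nr; lra.
have def := p_defect_le K0 MN a01 tail aV KM.
set g := _ - _ in def.
have Kn : (K <= n)%N by rewrite leq_addl.
have nK : (n - K)%N = m by rewrite addnK.
rewrite nK in g def.
have P0 : 0 < (p n)%:R :> R by rewrite ltr0n p_gt0.
have x0 : 0 <= 1 - a by lra.
have g0 : 0 <= g.
  rewrite subr_ge0 -nK -[X in X ^+ _ * _]/(1 - a).
  have KN : (K + N <= n)%N by apply: leq_trans MN; rewrite leq_add2r.
  by have := p_shift_le a01' (leq0n K) KN aV; rewrite !subn0.
have low : r ^+ 2 / 256 <= \sum_(K <= k < M.+1) k%:R * (1 - a) ^+ k.
  apply: (@le_trans _ _ (\sum_(H.+1 <= k < M.+1) (r / 16))).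
    rewrite sumr_const_nat -[leRHS]mulr_natr natrB; last exact: leqW HM.
    have : r / 16 * (r / 16) <= r / 16 * (M.+1%:R - H.+1%:R).
      by rewrite ler_wpM2l -?[M.+1%:R]natr1 -?[H.+1%:R]natr1; lra.
    lra.
  apply: (@le_trans _ _ (\sum_(H.+1 <= k < M.+1) k%:R * (1 - a) ^+ k)); last first.
    by apply: ler_sum_nat_sub => // k _; rewrite mulr_ge0 // exprn_ge0.
  rewrite !big_nat; apply: ler_sum => k /andP[Hk kM].
  have kH : H%:R + 1 <= k%:R :> R by rewrite natr1 ler_nat.
  have kM' : k%:R <= M%:R :> R by rewrite ler_nat.
  have := bernoulli_le k a01'.
  have : k%:R * a <= r / 4 * a by rewrite ler_wpM2r; lra.
  have -> : r / 4 * a = (c - e) / 4 by rewrite mulrAC -ar [r * a]mulrC.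
  move=> h1 h2; have -> : r / 16 = r / 8 * 2^-1 by lra.
  by apply: ler_pM; lra.
have gr : g <= rho * (p n)%:R.
  have h1 : g * (r ^+ 2 / 256) <= (zeta2 / a ^+ 2 - n%:R + C) * (p n)%:R.
    by apply: le_trans def; rewrite ler_wpM2l.
  (* As [c^2 = zeta2] and [a = (c - e) / r], the difference [zeta2 / a^2 - r^2] is of order [e r^2];
     the constant [16] suffices because [c - e >= c / 2]. *)
  have h2 : zeta2 / a ^+ 2 - n%:R + C <= r ^+ 2 * (16 * e + C / r ^+ 2).
    have -> : r ^+ 2 * (16 * e + C / r ^+ 2) = 16 * e * r ^+ 2 + C.
      by field; rewrite gt_eqF.
    rewrite lerD2r nr lerBlDr ler_pdivrMr ?exprn_gt0 //.
    have -> : (16 * e * r ^+ 2 + r ^+ 2) * a ^+ 2 = (16 * e + 1) * (c - e) ^+ 2.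
      by rewrite -ar; ring.
    rewrite -cz -subr_ge0.
    have -> : (16 * e + 1) * (c - e) ^+ 2 - c ^+ 2 = e * (16 * (c - e) ^+ 2 - 2 * c + e) by ring.
    rewrite mulr_ge0 //; first lra.
    have : 4^-1 * c ^+ 2 <= (c - e) ^+ 2.
      have -> : 4^-1 * c ^+ 2 = (c / 2) ^+ 2 by field.
      by rewrite lerXn2r ?nnegrE; lra.
    have : c * 1 <= c * c by rewrite ler_wpM2l; lra.
    by rewrite -expr2; lra.
  have h3 : r ^+ 2 * (16 * e + C / r ^+ 2) <= r ^+ 2 * t by rewrite ler_wpM2l ?sqr_ge0.
  have h4 := le_trans h1 (ler_wpM2r (ltW P0) (le_trans h2 h3)).
  rewrite rhoE -(ler_pM2l (exprn_gt0 2 r0)).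
  move: h4; rewrite mulrA ler_pdivrMr // mulrC => /le_trans; apply.
  by rewrite le_eqVlt; apply/orP; left; apply/eqP; ring.
have gE : (p m)%:R = (1 - a) ^+ K * (p n)%:R - g by rewrite subKr.
have bern := bernoulli_le K a01'.
have pm : (1 - K%:R * a - rho) * (p n)%:R <= (p m)%:R.
  have := ler_wpM2r (ltW P0) bern; rewrite gE; lra.
have KV : K%:R * (nu m)%:R <= (p n)%:R - (p m)%:R :> R.
  have := mul_nu_le K (leq_trans N0 Nm); rewrite -(ler_nat R) natrD natrM -/n; lra.
have Ka : K%:R * a <= c / q%:R.
  rewrite ler_pdivlMr; last lra.
  rewrite mulrAC; have := ler_wpM2r (ltW a0) Kqr; rewrite [r * a]mulrC ar; lra.
have V0 : 0 <= (nu m)%:R :> R by [].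
have h1 : r * (nu m)%:R <= (c + 8 * q%:R * rho) * (p n)%:R.
  have h : K%:R * (nu m)%:R <= (K%:R * a + rho) * (p n)%:R by lra.
  have K0'' : 0 < K%:R :> R by lra.
  rewrite -(ler_pM2l K0'') mulrCA.
  apply: le_trans (ler_wpM2l (ltW r0) h) _; rewrite [leLHS]mulrA [leRHS]mulrA ler_wpM2r ?(ltW P0) //.
  have -> : r * (K%:R * a + rho) = K%:R * (a * r) + r * rho by ring.
  rewrite ar; have := ler_wpM2r rho0 rKq.
  have := mulr_ge0 (ltW K0'') (ltW e0); lra.
have pm' : (1 - c / q%:R - rho) * (p n)%:R <= (p m)%:R.
  by apply: le_trans pm; rewrite ler_wpM2r ?(ltW P0) //; lra.
(* If the factor is not positive, the left side is at most zero; otherwise multiplying by it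
   converts [p n] into [p m]. *)
have [neg|pos] := leP (1 - c / q%:R - rho) 0.
  apply: (@le_trans _ _ 0).
    by rewrite mulr_le0_ge0 // mulr_ge0 // ltW.
  exact: mulr_ge0.
apply: le_trans (ler_wpM2l (ltW pos) h1) _.
by rewrite mulrCA ler_wpM2l.
Qed.

Lemma sqrt_shift_bounds (R : rcfType) (m K : nat) : K%:R <= Num.sqrt m%:R :> R ->
  1 <= Num.sqrt m%:R :> R -> 
  (Num.sqrt m%:R <= Num.sqrt (m + K)%:R :> R) && (Num.sqrt (m + K)%:R <= 2 * Num.sqrt m%:R :> R).
Proof.
move=> Ks s1; rewrite ler_wsqrtr ?ler_nat ?leq_addr //=.
have sE : Num.sqrt m%:R ^+ 2 = m%:R :> R by rewrite sqr_sqrtr.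
rewrite -[leRHS]ger0_norm ?mulr_ge0 ?sqrtr_ge0 // -sqrtr_sqr ler_wsqrtr // natrD -[X in X + _]sE.
by move: (Num.sqrt m%:R) Ks s1 {sE} => s Ks s1; nra.
Qed.

(** With [d = u - c], the choice of [q] makes [u c / q <= d / 4] and that of [rho] makes
    [(8 q + u) rho = d / 4]. *)
Lemma small_rho (R : realType) (c u : R) : 1 <= c -> c < u -> exists (q : nat) (rho : R),
  [/\ (16 <= q)%N, 0 < rho, 0 < 1 - c / q%:R - rho &
    c + 8 * q%:R * rho <= u * (1 - c / q%:R - rho)].
Proof.
move=> c1 cu; pose d := u - c; have d0 : 0 < d by rewrite subr_gt0.
have u0 : 0 < u by lra.
have [q1 _ hq1] := nat_above (4 * u * c / d).
exists (q1 + 16)%N; set q := (q1 + 16)%N.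
have qq : q%:R = q1%:R + 16 :> R by rewrite natrD.
have q0 : 0 < q%:R :> R by rewrite ltr0n addn_gt0 orbT.
have uq : u * (c / q%:R) <= d / 4.
  rewrite mulrA ler_pdivrMr //; move: hq1; rewrite ler_pdivrMr // => h.
  have := mulr_ge0 (ltW d0) (ler0n R q1); rewrite qq; lra.
have rd0 : 0 < 4 * (8 * q%:R + u) by lra.
pose rho := d / (4 * (8 * q%:R + u)).
have rho0 : 0 < rho by rewrite divr_gt0.
have rhoE : rho * (4 * (8 * q%:R + u)) = d by rewrite divfK // gt_eqF.
have k1 : c + 8 * q%:R * rho <= u * (1 - c / q%:R - rho).
  have : u * rho + 8 * q%:R * rho = d / 4 by lra.
  by rewrite /d in uq *; lra.
exists rho; split => //; first by rewrite leq_addl.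
have : 0 < u * (1 - c / q%:R - rho).
  by apply: lt_le_trans k1; have := mulr_ge0 (ltW q0) (ltW rho0); lra.
by rewrite pmulr_rgt0.
Qed.

(** Size conditions of [nu_upper_step], with [s], [r] and [x] standing for [sqrt m], [sqrt (m + K)]
    and [K q]. *)
Lemma scale_bounds (R : realFieldType) (s r x N C t e : R) :
  34 <= s -> s <= r -> r <= 2 * s -> x <= s -> s <= 4 * x -> N <= s ->
  0 < t -> 0 <= C -> C / (t / 2) <= s -> e <= t / 32 ->
  [/\ r <= 8 * x, x <= r, r / 4 + N <= r ^+ 2, 16 <= r & 16 * e + C / r ^+ 2 <= t].
Proof.
move=> s34 sr rs xs sx Ns t0 C0 Cs et.
have r2 : r * 4 <= r ^+ 2 by rewrite expr2 ler_wpM2l; lra.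
split; [lra|lra|lra|lra|].
have r0 : 0 < r ^+ 2 by rewrite exprn_gt0 //; lra.
have : C / r ^+ 2 <= t / 2.
  move: Cs; rewrite !ler_pdivrMr //; last lra.
  by move=> h; apply: (le_trans h); rewrite mulrC ler_wpM2l; lra.
lra.
Qed.

Lemma nu_upper (R : realType) (u : R) : Num.sqrt zeta2 < u ->
  \forall n \near \oo, Num.sqrt n%:R * (nu n)%:R <= u * (p n)%:R.
Proof.
set c := Num.sqrt zeta2 => cu.
have z0 : 0 <= zeta2 :> R by apply: le_trans ler01 (zeta2_ge1 R).
have c1 : 1 <= c by rewrite -sqrtr1 ler_wsqrtr // zeta2_ge1.
have cz : c ^+ 2 = zeta2 by rewrite sqr_sqrtr.
have c2 : c <= 2.
  by rewrite -[leRHS]ger0_norm // -sqrtr_sqr ler_wsqrtr // -natrX zeta2_le4.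
have c12 : 1 <= c <= 2 by rewrite c1.
have [q [rho [q16 rho0 kpos k1]]] := small_rho c1 cu.
have q16' : 16 <= q%:R :> R by rewrite ler_nat.
have q0n : (0 < q)%N by exact: leq_trans q16.
pose t := rho / 256.
have t0 : 0 < t by exact: divr_gt0.
have rhoE : rho = 256 * t by rewrite mulrC divfK.
pose e := Num.min 2^-1 (t / 32).
have e0 : 0 < e by rewrite lt_min invr_gt0 ltr0Sn /=; exact: divr_gt0.
have er : e <= t / 32 by rewrite ge_min lexx orbT.
have e02 : 0 < e <= 2^-1 by rewrite e0 ge_min lexx.
have ce : c - e < c by rewrite gtrBl.
have [N1 hN1] := near_infty_nat (nu_lower ce).
pose N := N1.+1; have [C C0 tail] := sum_sigma_p_tail R N.
near=> m.
have mq : 2 * q%:R + 2 <= Num.sqrt m%:R :> R by near: m; exact: near_sqrt_ge.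
have mN : (N <= m)%N by near: m; exact: nbhs_infty_ge.
have mN' : N%:R <= Num.sqrt m%:R :> R by near: m; exact: near_sqrt_ge.
have mC : C / (t / 2) <= Num.sqrt m%:R :> R by near: m; exact: near_sqrt_ge.
(* [K] is of order [sqrt m / q]; the estimate at [m] uses [m + K] as the larger argument. *)
have [K0 [K [_ /andP[Kpos _] /andP[Kq sK]]]] := floor_div_bounds q0n mq.
have s34 : 34 <= Num.sqrt m%:R :> R by apply: le_trans mq; clear -q16'; lra.
have Ks : K%:R <= Num.sqrt m%:R :> R.
  by apply: le_trans Kq; rewrite ler_peMr // ler1n.
have s1 : 1 <= Num.sqrt m%:R :> R by apply: le_trans s34; rewrite ler1n.
have /andP[sr rs] := sqrt_shift_bounds Ks s1.
have r0 : 0 < Num.sqrt (m + K)%:R :> R by apply: lt_le_trans sr; exact: lt_le_trans ltr01 s1.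
have rE : (m + K)%:R = Num.sqrt (m + K)%:R ^+ 2 :> R by rewrite sqr_sqrtr.
have [rK Kr rN r16 ht] := scale_bounds s34 sr rs Kq sK mN' t0 C0 mC er.
have Nn : (N <= m + K)%N by exact: leq_trans mN (leq_addr _ _).
have aV i : (N <= i <= m + K)%N ->
    (c - e) / Num.sqrt (m + K)%:R * (p i)%:R <= (nu i)%:R.
  move=> /andP[Ni im]; rewrite mulrAC ler_pdivrMr //.
  apply: le_trans (hN1 i (ltnW Ni)) _; rewrite mulrC ler_wpM2l //.
  by rewrite ler_wsqrtr // ler_nat.
have main := nu_upper_step (isT : (0 < N)%N) mN Kpos q16 r0 rE rK Kr rN r16 c12 cz e02 C0 ht rhoE (tail _ Nn) aV.
(* Lowering [sqrt (m + K)] to [sqrt m] only decreases the left side. *)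
apply: (@le_trans _ _ (Num.sqrt (m + K)%:R * (nu m)%:R)); first by rewrite ler_wpM2r.
rewrite -(ler_pM2l kpos); apply: (le_trans main).
by rewrite mulrA ler_wpM2r // [leRHS]mulrC.
Unshelve. all: by end_near. Qed.

Theorem theorem1 (R : realType) :
  (fun n : nat => (p n)%:R / ((nu n)%:R * Num.sqrt (n%:R / (@zeta2 R))))
    @ \oo --> (1 : R).
Proof.
have z0 : 0 <= zeta2 :> R by apply: le_trans ler01 (zeta2_ge1 R).
have c1 : 1 <= Num.sqrt zeta2 :> R by rewrite -sqrtr1 ler_wsqrtr // zeta2_ge1.
have c0 : 0 < Num.sqrt zeta2 :> R by apply: lt_le_trans c1.
have h : (fun n : nat => Num.sqrt n%:R * (nu n)%:R / (p n)%:R) @ \oo --> (Num.sqrt zeta2 : R).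
  apply/cvgrPdist_le => e e0.
  have lo : Num.sqrt zeta2 - e < Num.sqrt zeta2 :> R by rewrite gtrBl.
  have up : Num.sqrt zeta2 < Num.sqrt zeta2 + e :> R by rewrite ltrDl.
  near=> n.
  have P0 : 0 < (p n)%:R :> R by rewrite ltr0n p_gt0.
  rewrite ler_distlC ler_pdivlMr // ler_pdivrMr //; apply/andP; split; near: n.
    exact: nu_lower.
  exact: nu_upper.
(* The equality holds at every [n], even where [nu n] or [n] vanishes, because [0^-1 = 0]. *)
rewrite (_ : (fun n => _) =
    (fun n => Num.sqrt zeta2 * (Num.sqrt n%:R * (nu n)%:R / (p n)%:R)^-1)); last first.
  by apply/funext => n; rewrite sqrtrM // sqrtrV // !invfM !invrK; ring.
rewrite -[X in _ --> X](divff (lt0r_neq0 c0)).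
by apply: cvgM; [exact: cvg_cst|apply: cvgV => //; rewrite gt_eqF].
Unshelve. all: by end_near. Qed.
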